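(* Let $\mathbf{a}$ be a PA degree. Then there is a countable existentially closed group $M$ such that for every $G\in\mathrm{Sk}(M)$, $W(G)\leq_{\mathrm{T}}\mathbf{a}$.
   Context: A group $M$ is existentially closed if for every quantifier-free formula $\varphi(\overline{x},\overline{m})$ in the language of groups $\{1,\cdot,{}^{-1}\}$ with parameters from $M$, if some group $N\geq M$ satisfies $\exists\overline{x}\,\varphi(\overline{x},\overline{m})$, then so does $M$. All existentially closed groups are assumed countable. $\mathrm{Sk}(M)$ is the collection of finitely generated subgroups of $M$. For a finitely generated group $G$ with finite generating set $X$, $W(G)$ is the (coded) set of words on $X$ equal to $1$ in $G$; its Turing degree does not depend on $X$. A PA degree is a Turing degree that computes a complete (consistent) extension of Peano arithmetic; equivalently, one that computes an element of every nonempty $\Pi^0_1$-class in $2^\omega$. *)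

(* Defs.v *)
From Stdlib Require Cantor.
From HB Require Import structures.
From mathcomp Require Import all_boot.
From mathcomp Require Import boolp classical_sets functions cardinality.

Set Implicit Arguments.
Unset Strict Implicit.
Unset Printing Implicit Defensive.

Local Open Scope classical_set_scope.

Definition pair_code (a b : nat) : nat := Cantor.to_nat (a, b).

(** * Oracle computability and Turing degrees

    Kleene's partial recursive functions relative to an oracle, presented with
    one argument; tuples are coded with the (bijective) Cantor pairing. *)

Inductive code : Type :=
| CZero | CSucc | CFst | CSnd | COracle
| CPair of code & code
| CComp of code & code
| CPrec of code & code
| CMu of code.

(* [eval A c n y]: the program [c] with oracle [A] halts on [n] with value [y]. *)
Inductive eval (A : set nat) : code -> nat -> nat -> Prop :=
| eval_zero n : eval A CZero n 0
| eval_succ n : eval A CSucc n n.+1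
| eval_fst a b : eval A CFst (pair_code a b) a
| eval_snd a b : eval A CSnd (pair_code a b) b
| eval_oracle_in n : A n -> eval A COracle n 1
| eval_oracle_out n : ~ A n -> eval A COracle n 0
| eval_pair c d n y z :
    eval A c n y -> eval A d n z -> eval A (CPair c d) n (pair_code y z)
| eval_comp c d n y z :
    eval A d n y -> eval A c y z -> eval A (CComp c d) n z
| eval_prec0 c d a y :
    eval A c a y -> eval A (CPrec c d) (pair_code a 0) y
| eval_precS c d a k y z :
    eval A (CPrec c d) (pair_code a k) y ->
    eval A d (pair_code a (pair_code k y)) z ->
    eval A (CPrec c d) (pair_code a k.+1) z
| eval_mu c a k :
    eval A c (pair_code a k) 0 ->
    (forall i, i < k -> exists y, eval A c (pair_code a i) y.+1) ->
    eval A (CMu c) a k.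

Definition turing_le (X A : set nat) : Prop :=
  exists c : code, forall n : nat,
    (X n -> eval A c n 1) /\ (~ X n -> eval A c n 0).

Definition turing_equiv (A B : set nat) : Prop :=
  turing_le A B /\ turing_le B A.

Definition turing_degree (a : set (set nat)) : Prop :=
  exists A : set nat, a = [set B | turing_equiv B A].

Definition computed_by_degree (X : set nat) (a : set (set nat)) : Prop :=
  exists A : set nat, a A /\ turing_le X A.

(** * First-order arithmetic, with de Bruijn indices *)

Inductive tm : Type :=
| Var of nat | Zero | Succ of tm | Add of tm & tm | Mul of tm & tm.

Inductive form : Type :=
| Bot | Eq of tm & tm | Imp of form & form | All of form.

Definition Neg (phi : form) : form := Imp phi Bot.

Fixpoint tm_subst (s : nat -> tm) (t : tm) : tm :=
  match t with
  | Var n => s n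
  | Zero => Zero
  | Succ t1 => Succ (tm_subst s t1)
  | Add t1 t2 => Add (tm_subst s t1) (tm_subst s t2)
  | Mul t1 t2 => Mul (tm_subst s t1) (tm_subst s t2)
  end.

Definition shift (n : nat) : tm := Var n.+1.

Definition up (s : nat -> tm) (n : nat) : tm :=
  if n is m.+1 then tm_subst shift (s m) else Var 0.

(* Replaces variable 0 by [t] and lowers the other variables. *)
Definition inst (t : tm) (n : nat) : tm := if n is m.+1 then Var m else t.

(* Replaces variable 0 by its successor. *)
Definition bump (n : nat) : tm := if n is 0 then Succ (Var 0) else Var n.

Fixpoint subst (s : nat -> tm) (phi : form) : form :=
  match phi with
  | Bot => Bot
  | Eq t1 t2 => Eq (tm_subst s t1) (tm_subst s t2)
  | Imp phi1 phi2 => Imp (subst s phi1) (subst s phi2)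
  | All phi1 => All (subst (up s) phi1)
  end.

Fixpoint tm_bounded (n : nat) (t : tm) : bool :=
  match t with
  | Var i => i < n
  | Zero => true
  | Succ t1 => tm_bounded n t1
  | Add t1 t2 | Mul t1 t2 => tm_bounded n t1 && tm_bounded n t2
  end.

Fixpoint bounded (n : nat) (phi : form) : bool :=
  match phi with
  | Bot => true
  | Eq t1 t2 => tm_bounded n t1 && tm_bounded n t2
  | Imp phi1 phi2 => bounded n phi1 && bounded n phi2
  | All phi1 => bounded n.+1 phi1
  end.

Definition sentence (phi : form) : bool := bounded 0 phi.

(* Classical natural deduction with equality. *)
Inductive proves : set form -> form -> Prop :=
| pr_hyp (G : set form) phi : G phi -> proves G phi
| pr_impI (G : set form) phi psi :
    proves (phi |` G) psi -> proves G (Imp phi psi)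
| pr_impE (G : set form) phi psi :
    proves G (Imp phi psi) -> proves G phi -> proves G psi
| pr_raa (G : set form) phi : proves (Neg phi |` G) Bot -> proves G phi
| pr_allI (G : set form) phi :
    proves [set subst shift psi | psi in G] phi -> proves G (All phi)
| pr_allE (G : set form) phi t :
    proves G (All phi) -> proves G (subst (inst t) phi)
| pr_refl (G : set form) t : proves G (Eq t t)
| pr_eqE (G : set form) s t phi :
    proves G (Eq s t) -> proves G (subst (inst s) phi) ->
    proves G (subst (inst t) phi).

Definition induction_for (phi : form) : form :=
  Imp (subst (inst Zero) phi)
      (Imp (All (Imp phi (subst bump phi))) (All phi)).

Inductive peano : set form :=
| PA_succ_neq0 : peano (All (Neg (Eq (Succ (Var 0)) Zero)))
| PA_succ_inj :
    peano (All (All (Imp (Eq (Succ (Var 1)) (Succ (Var 0)))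
                         (Eq (Var 1) (Var 0)))))
| PA_add0 : peano (All (Eq (Add (Var 0) Zero) (Var 0)))
| PA_addS :
    peano (All (All (Eq (Add (Var 1) (Succ (Var 0)))
                        (Succ (Add (Var 1) (Var 0))))))
| PA_mul0 : peano (All (Eq (Mul (Var 0) Zero) Zero))
| PA_mulS :
    peano (All (All (Eq (Mul (Var 1) (Succ (Var 0)))
                        (Add (Mul (Var 1) (Var 0)) (Var 1)))))
(* The parameters of [phi] are closed off by [n] outer quantifiers. *)
| PA_ind (n : nat) (phi : form) :
    sentence (iter n All (induction_for phi)) ->
    peano (iter n All (induction_for phi)).

Definition complete_extension_of_PA (T : set form) : Prop :=
  [/\ T `<=` [set phi | sentence phi],
      peano `<=` T,
      ~ proves T Bot &
      forall phi, sentence phi -> T phi \/ T (Neg phi)].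

Fixpoint tm_code (t : tm) : nat :=
  match t with
  | Var n => pair_code 0 n
  | Zero => pair_code 1 0
  | Succ t1 => pair_code 2 (tm_code t1)
  | Add t1 t2 => pair_code 3 (pair_code (tm_code t1) (tm_code t2))
  | Mul t1 t2 => pair_code 4 (pair_code (tm_code t1) (tm_code t2))
  end.

Fixpoint form_code (phi : form) : nat :=
  match phi with
  | Bot => pair_code 0 0
  | Eq t1 t2 => pair_code 1 (pair_code (tm_code t1) (tm_code t2))
  | Imp phi1 phi2 => pair_code 2 (pair_code (form_code phi1) (form_code phi2))
  | All phi1 => pair_code 3 (form_code phi1)
  end.

Definition PA_degree (a : set (set nat)) : Prop :=
  turing_degree a /\
  exists T : set form, complete_extension_of_PA T /\
    computed_by_degree [set form_code phi | phi in T] a.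

(** * Existentially closed groups *)

(* Terms and quantifier-free formulas of the language of groups, with
   parameters from [P] and variables indexed by [nat]. *)
Inductive gterm (P : Type) : Type :=
| GVar of nat | GParam of P | GOne
| GMul of gterm P & gterm P
| GInv of gterm P.

Arguments GVar {P}.
Arguments GOne {P}.

Inductive qfform (P : Type) : Type :=
| QEq of gterm P & gterm P
| QNot of qfform P
| QAnd of qfform P & qfform P
| QOr of qfform P & qfform P.

Fixpoint gterm_val (P : Type) (N : groupType) (par : P -> N) (x : nat -> N)
    (t : gterm P) : N :=
  match t with
  | GVar n => x n
  | GParam p => par p
  | GOne => 1%g
  | GMul t1 t2 => (gterm_val par x t1 * gterm_val par x t2)%g
  | GInv t1 => (gterm_val par x t1)^-1%g
  end.

Fixpoint qf_holds (P : Type) (N : groupType) (par : P -> N) (x : nat -> N)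
    (phi : qfform P) : Prop :=
  match phi with
  | QEq t1 t2 => gterm_val par x t1 = gterm_val par x t2
  | QNot phi1 => ~ qf_holds par x phi1
  | QAnd phi1 phi2 => qf_holds par x phi1 /\ qf_holds par x phi2
  | QOr phi1 phi2 => qf_holds par x phi1 \/ qf_holds par x phi2
  end.

(* A group [N >= M] is given by an injective homomorphism [j] from [M] to [N]. *)
Definition existentially_closed (M : groupType) : Prop :=
  forall (phi : qfform M) (N : groupType) (j : {multiplicative M -> N}),
    injective j ->
    (exists x : nat -> N, qf_holds j x phi) ->
    exists x : nat -> M, qf_holds id x phi.

(** * Finitely generated subgroups and their word problems *)

Definition subgroup (M : groupType) (H : set M) : Prop :=
  [/\ H 1%g, forall x y, H x -> H y -> H (x * y)%g
    & forall x, H x -> H x^-1%g].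

Definition generated (M : groupType) (X : set M) : set M :=
  smallest (@subgroup M) X.

Definition Sk (M : groupType) : set (set M) :=
  [set G | exists X : seq M, G = generated [set` X]].
Arguments Sk : clear implicits.

(* The letter [(i, e)] stands for the [i]-th generator, inverted if [e]. *)
Definition word (n : nat) : Type := seq ('I_n * bool).

Definition word_val (M : groupType) (n : nat) (X : n.-tuple M) (w : word n) : M :=
  (\prod_(l <- w) if l.2 then (tnth X l.1)^-1 else tnth X l.1)%g.

Definition word_code (n : nat) (w : word n) : nat :=
  foldr (fun (l : 'I_n * bool) (c : nat) => (pair_code (l.1.*2 + l.2) c).+1) 0 w.

(* The word problem with respect to the generators listed in [X]. *)
Definition W (M : groupType) (X : seq M) : set nat :=
  [set word_code w | w in [set w : word (size X) |
                            word_val (in_tuple X) w = 1%g]].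

(* Main.v *)
Require Import Defs.
From Stdlib Require Cantor.
From HB Require Import structures.
From mathcomp Require Import all_boot zify.
From mathcomp Require Import boolp classical_sets functions cardinality.

Set Implicit Arguments.
Unset Strict Implicit.
Unset Printing Implicit Defensive.

Local Open Scope classical_set_scope.

(** Fix a complete extension [T] of PA below the degree, and a model [D] of [T].
    The sets of natural numbers defined in [D] by formulas without parameters
    are computable from [T], and they form a Scott set: for a universal
    condition on a set [Y] with a solution among all sets of numbers, the
    leftmost path through the tree of partial solutions, as computed inside
    [D], is a solution which is so defined. Such conditions can say that [Y]
    codes the multiplication of a group generated by [h 0, h 1, ...] which
    contains a given finitely generated group [G] and satisfies finitely many
    equations and inequations. So if finitely many equations and inequations
    over [G] are solvable in an extension of [G], then they are solvable in a
    finitely generated extension of [G] whose word problem is again so defined.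
    The union of a chain of such extensions, which meets all solvable
    tasks, is the required group. *)

(** The obstacle is iteration. The conditions on the next group are $\Pi^0_1$ relative to the word
    problem of the present one, and a PA degree need not be PA relative to a set that it computes,
    so the basis theorem for $\Pi^0_1$ classes cannot simply be applied again and again.
    Definability in one fixed model removes this: the formula that defines the present word problem
    becomes part of the next condition, and the new solution is again given by a formula. Absence of
    parameters makes each membership question a sentence, which the theory decides. Working in a
    model rather than with derivations allows properties of codes to be checked semantically. But
    the model may be nonstandard, and a condition true of all natural numbers may fail at
    nonstandard arguments; hence partial solutions are only asked to satisfy it below a bound. *)

Lemma pair_code_inj a b c d : pair_code a b = pair_code c d -> a = c /\ b = d.
Proof.
move=> /(congr1 Cantor.of_nat).
by rewrite /pair_code !Cantor.cancel_of_to => -[-> ->].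
Qed.

Lemma pair_codeP n : exists a b, n = pair_code a b.
Proof.
exists (Cantor.of_nat n).1, (Cantor.of_nat n).2.
by rewrite /pair_code -surjective_pairing Cantor.cancel_to_of.
Qed.

Lemma tm_code_inj : injective tm_code.
Proof.
elim=> [n||t IHt|t IHt u IHu|t IHt u IHu] [m||t'|t' u'|t' u'] //=
  /pair_code_inj[]// _.
- by move->.
- by move/IHt->.
- by move=> /pair_code_inj[/IHt-> /IHu->].
- by move=> /pair_code_inj[/IHt-> /IHu->].
Qed.

Lemma form_code_inj : injective form_code.
Proof.
elim=> [|t u|f IHf g IHg|f IHf] [|t' u'|f' g'|f'] //= /pair_code_inj[]// _.
- by move=> /pair_code_inj[/tm_code_inj-> /tm_code_inj->].
- by move=> /pair_code_inj[/IHf-> /IHg->].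
- by move/IHf->.
Qed.

(** * Substitution *)

Definition scons {X : Type} (x : X) (s : nat -> X) (n : nat) : X :=
  if n is m.+1 then s m else x.

Lemma tm_subst_comp s t u :
  tm_subst s (tm_subst t u) = tm_subst (tm_subst s \o t) u.
Proof. by elim: u => //= [u ->|u -> v ->|u -> v ->]. Qed.

Lemma up_comp s t : tm_subst (up s) \o up t = up (tm_subst s \o t).
Proof. by apply/funext => -[|n] //=; rewrite !tm_subst_comp. Qed.

Lemma subst_comp s t phi :
  subst s (subst t phi) = subst (tm_subst s \o t) phi.
Proof.
elim: phi s t => //= [u v|f IHf g IHg|f IHf] s t.
- by rewrite !tm_subst_comp.
- by rewrite IHf IHg.
- by rewrite IHf up_comp.
Qed.

Lemma tm_subst_var u : tm_subst Var u = u.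
Proof. by elim: u => //= [u ->|u -> v ->|u -> v ->]. Qed.

Lemma subst_var phi : subst Var phi = phi.
Proof.
elim: phi => //= [u v|f -> g ->|f IHf] //; first by rewrite !tm_subst_var.
by rewrite (_ : up Var = Var) ?IHf//; apply/funext => -[].
Qed.

Lemma eq_tm_subst_bounded n s t u : tm_bounded n u ->
  (forall i, i < n -> s i = t i) -> tm_subst s u = tm_subst t u.
Proof.
move=> + st; elim: u => //= [u IHu /IHu->//|u IHu v IHv|u IHu v IHv];
  by move=> /andP[/IHu-> /IHv->].
Qed.

Lemma eq_subst_bounded n s t phi : bounded n phi ->
  (forall i, i < n -> s i = t i) -> subst s phi = subst t phi.
Proof.
elim: phi n s t => //= [u v|f IHf g IHg|f IHf] n s t.
- by move=> /andP[bu bv] st; rewrite !(eq_tm_subst_bounded (t := t) _ st).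
- by move=> /andP[bf bg] st; rewrite (IHf n s t)// (IHg n s t).
- by move=> bf st; rewrite (IHf n.+1 (up s) (up t))// => -[|i] //= /st->.
Qed.

Lemma subst_sentence s phi : sentence phi -> subst s phi = phi.
Proof. by move=> /(@eq_subst_bounded 0 s Var)->; rewrite ?subst_var. Qed.

Lemma tm_bounded_le m n u : m <= n -> tm_bounded m u -> tm_bounded n u.
Proof.
move=> mn; elim: u => //= [i|u IHu v IHv|u IHu v IHv]; first by move=> /leq_trans->.
- by move=> /andP[/IHu-> /IHv->].
- by move=> /andP[/IHu-> /IHv->].
Qed.

Lemma bounded_le m n phi : m <= n -> bounded m phi -> bounded n phi.
Proof.
elim: phi m n => //= [u v|f IHf g IHg|f IHf] m n mn.
- by move=> /andP[/(tm_bounded_le mn)-> /(tm_bounded_le mn)->].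
- by move=> /andP[/(IHf _ _ mn)-> /(IHg _ _ mn)->].
- exact: IHf.
Qed.

Lemma tm_bounded_ex u : exists n, tm_bounded n u.
Proof.
elim: u => /= [i||u [n un]|u [n un] v [m vm]|u [n un] v [m vm]].
- by exists i.+1.
- by exists 0.
- by exists n.
- by exists (maxn n m);
    rewrite (tm_bounded_le _ un) ?leq_maxl// (tm_bounded_le _ vm) ?leq_maxr.
- by exists (maxn n m);
    rewrite (tm_bounded_le _ un) ?leq_maxl// (tm_bounded_le _ vm) ?leq_maxr.
Qed.

Lemma bounded_ex phi : exists n, bounded n phi.
Proof.
elim: phi => /= [|u v|f [n fn] g [m gm]|f [n fn]].
- by exists 0.
- have [[n un] [m vm]] := (tm_bounded_ex u, tm_bounded_ex v).
  by exists (maxn n m);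
    rewrite (tm_bounded_le _ un) ?leq_maxl// (tm_bounded_le _ vm) ?leq_maxr.
- by exists (maxn n m); rewrite (bounded_le _ fn) ?leq_maxl// (bounded_le _ gm) ?leq_maxr.
- by exists n; apply: bounded_le fn.
Qed.

Lemma tm_bounded_subst m n s u : tm_bounded m u ->
  (forall i, i < m -> tm_bounded n (s i)) -> tm_bounded n (tm_subst s u).
Proof.
move=> + sn; elim: u => //= [u IHu v IHv|u IHu v IHv];
  by move=> /andP[/IHu-> /IHv->].
Qed.

Lemma bounded_subst m n s phi : bounded m phi ->
  (forall i, i < m -> tm_bounded n (s i)) -> bounded n (subst s phi).
Proof.
elim: phi m n s => //= [u v|f IHf g IHg|f IHf] m n s.
- by move=> /andP[bu bv] sn; rewrite !(tm_bounded_subst (m := m)).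
- by move=> /andP[bf bg] sn; rewrite (IHf m)// (IHg m).
- move=> bf sn; apply: IHf bf _ => -[|i] //= /sn.
  by move/tm_bounded_subst; apply.
Qed.

(** * Completeness theorem *)

Lemma proves_weaken G G' phi : G `<=` G' -> proves G phi -> proves G' phi.
Proof.
move=> + p; elim: p G' => {G phi} [G phi Gp|G phi psi _ IH|G phi psi _ IH1 _ IH2
  |G phi _ IH|G phi _ IH|G phi t _ IH|G t|G s t phi _ IH1 _ IH2] G' GG'.
- exact/pr_hyp/GG'.
- by apply/pr_impI/IH/setUS.
- by apply: (pr_impE (IH1 _ GG')); exact: IH2.
- by apply/pr_raa/IH/setUS.
- by apply/pr_allI/IH/image_subset.
- exact/pr_allE/IH.
- exact: pr_refl.
- by apply: (pr_eqE (IH1 _ GG')); exact: IH2.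
Qed.

Lemma proves_subst G phi s :
  proves G phi -> proves (subst s @` G) (subst s phi).
Proof.
move=> p; elim: p s => {G phi} [G phi Gp|G phi psi _ IH|G phi psi _ IH1 _ IH2
  |G phi _ IH|G phi _ IH|G phi t _ IH|G u|G u v phi _ IH1 _ IH2] s.
- by apply: pr_hyp; exists phi.
- by apply: pr_impI; rewrite -[[set subst s phi]]image_set1 -image_setU; exact: IH.
- exact: pr_impE (IH1 s) (IH2 s).
- apply: pr_raa; rewrite -[[set Neg _]](image_set1 (subst s) (Neg phi)) -image_setU.
  exact: IH.
- apply: pr_allI; apply: proves_weaken (IH (up s)).
  move=> _ [_ [psi Gpsi <-] <-]; exists (subst s psi); first by exists psi.
  by rewrite !subst_comp.
- rewrite subst_comp (_ : _ \o _ = tm_subst (inst (tm_subst s t)) \o up s).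
    by rewrite -subst_comp; apply: pr_allE; exact: IH.
  apply/funext => -[|n] //=; rewrite tm_subst_comp.
  by rewrite (_ : _ \o shift = Var) ?tm_subst_var.
- exact: pr_refl.
- have eqs w : subst s (subst (inst w) phi) =
      subst (inst (tm_subst s w)) (subst (up s) phi).
    rewrite !subst_comp; congr subst; apply/funext => -[|n] //=.
    by rewrite tm_subst_comp (_ : _ \o shift = Var) ?tm_subst_var.
  by rewrite eqs; apply: pr_eqE (IH1 s) _; rewrite -eqs.
Qed.

(** Free variables play the part of Henkin constants: the substitution that sends variable [k] to 0
    and raises the smaller ones turns the given derivation into the premise of generalization. *)
Lemma proves_all_fresh G k phi : (forall psi, G psi -> bounded k psi) ->
  bounded k (All phi) -> proves G (subst (inst (Var k)) phi) ->
  proves G (All phi).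
Proof.
move=> bG /= bphi p; apply: pr_allI.
pose s n := if n < k then Var n.+1 else Var 0.
have := proves_subst s p.
rewrite subst_comp (@eq_subst_bounded k.+1 _ Var) ?subst_var//.
  apply: proves_weaken => _ [psi Gpsi <-]; exists psi => //.
  by apply: (@eq_subst_bounded k) (bG _ Gpsi) _ => i ik; rewrite /s ik.
by move=> -[|i] /=; rewrite /s ?ltnn// ltnS => ->.
Qed.

(** A derivation uses finitely many hypotheses. The induction is over all chains, since the rules
    change the context. *)
Lemma proves_compact (G : nat -> set form) phi :
  (forall m n, m <= n -> G m `<=` G n) ->
  proves (\bigcup_n G n) phi -> exists n, proves (G n) phi.
Proof.
move=> mG p; move: p mG; move EU : (\bigcup_n G n) => U p.
elim: p G EU => {U phi} [U phi Up|U phi psi _ IH|U phi psi _ IH1 _ IH2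
  |U phi _ IH|U phi _ IH|U phi t _ IH|U u|U u v phi _ IH1 _ IH2] G UE mG.
- by move: Up; rewrite -UE => -[n _ Gn]; exists n; exact: pr_hyp.
- have [|m n mn|n pn] := IH (fun n => phi |` G n).
  + by rewrite -UE bigcupUr//; exists 0.
  + exact/setUS/mG.
  + by exists n; exact: pr_impI.
- have [[m pm] [n pn]] := (IH1 G UE mG, IH2 G UE mG).
  exists (maxn m n).
  apply: (@pr_impE _ phi); [apply: proves_weaken pm|apply: proves_weaken pn].
    exact/mG/leq_maxl.
  exact/mG/leq_maxr.
- have [|m n mn|n pn] := IH (fun n => Neg phi |` G n).
  + by rewrite -UE bigcupUr//; exists 0.
  + exact/setUS/mG.
  + by exists n; exact: pr_raa.
- have [|m n mn|n pn] := IH (fun n => subst shift @` G n).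
  + by rewrite -UE image_bigcup.
  + exact/image_subset/mG.
  + by exists n; exact: pr_allI.
- by have [n pn] := IH G UE mG; exists n; exact: pr_allE.
- by exists 0; exact: pr_refl.
- have [[m pm] [n pn]] := (IH1 G UE mG, IH2 G UE mG).
  exists (maxn m n).
  apply: (@pr_eqE _ u); [apply: proves_weaken pm|apply: proves_weaken pn].
    exact/mG/leq_maxl.
  exact/mG/leq_maxr.
Qed.

(** The second alternative includes Henkin's condition, for the quantifier case of the truth
    lemma. *)
Definition decided (G : set form) phi :=
  G phi \/ proves G (Neg phi) /\
    forall psi, phi = All psi -> exists t, proves G (Neg (subst (inst t) psi)).

(** The bound on free variables keeps a variable available as a fresh witness. *)
Definition henkin_stage (G : set form) :=
  (exists k, forall psi, G psi -> bounded k psi) /\ ~ proves G Bot.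

Lemma henkin_step G phi : henkin_stage G ->
  exists G', [/\ henkin_stage G', G `<=` G' & decided G' phi].
Proof.
move=> [[k bG] conG].
have [m bm] := bounded_ex phi.
pose K := maxn k m.
have bGK psi : G psi -> bounded K psi.
  by move/bG; apply: bounded_le; rewrite leq_maxl.
have bphi : bounded K phi by apply: bounded_le bm; rewrite leq_maxr.
have [phiBot|] := pselect (proves (phi |` G) Bot); last first.
  move=> con; exists (phi |` G); split; [|exact: subsetUr|by left; left].
  by split=> //; exists K => psi [->//|/bGK].
have GN : proves G (Neg phi) by exact: pr_impI.
have [[psi phiE]|nall] := pselect (exists psi, phi = All psi); last first.
  exists G; split=> //; first by split=> //; exists k.
  by right; split=> // psi phiE; case: nall; exists psi.
(* [Var K] is fresh for [G] and [phi]. Refuting its instance is consistent, since otherwise the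
   universal formula would be provable. *)
set w := Neg (subst (inst (Var K)) psi).
exists (w |` G); split; [|exact: subsetUr|right; split].
- split.
    exists K.+1 => chi [->|/bGK]; last exact: bounded_le.
    rewrite /= andbT; apply: (@bounded_subst K.+1).
      by move: bphi; rewrite phiE.
    by move=> -[|i] //= /ltnW; rewrite ltnS.
  move=> wBot; apply: conG; apply: (pr_impE GN).
  rewrite phiE; apply: (@proves_all_fresh _ K) => //; first by rewrite -phiE.
  exact: pr_raa.
- by apply: proves_weaken GN; exact: subsetUr.
- by move=> _ /(eq_trans (esym phiE))[<-]; exists (Var K); apply: pr_hyp; left.
Qed.

Lemma henkin_extension T : T `<=` [set phi | sentence phi] -> ~ proves T Bot ->
  exists G, [/\ T `<=` G, ~ proves G Bot & forall phi, decided G phi].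
Proof.
move=> sT conT.
have step n (G : {G | henkin_stage G}) : exists G' : {G | henkin_stage G},
    sval G `<=` sval G' /\
    forall phi, form_code phi = n -> decided (sval G') phi.
  have [[phi phin]|nphi] := pselect (exists phi, form_code phi = n).
    have [G' [G'1 GG' G'phi]] := henkin_step phi (svalP G).
    by exists (exist _ G' G'1); split=> // psi; rewrite -phin => /form_code_inj->.
  by exists G; split=> // phi phin; case: nphi; exists phi.
pose f n := projT1 (choice (step n)).
have fP n G : sval G `<=` sval (f n G) /\
    forall phi, form_code phi = n -> decided (sval (f n G)) phi.
  exact: (projT2 (choice (step n)) G).
have T0 : henkin_stage T by split=> //; exists 0.
pose G := fix G n := if n is m.+1 then f m (G m) else exist _ T T0.
have GS n : sval (G n) `<=` sval (G n.+1) by case: (fP n (G n)).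
have mG m n : m <= n -> sval (G m) `<=` sval (G n).
  move=> /subnK <-; elim: (n - m) => // d IH; rewrite addSn.
  exact: subset_trans IH (GS _).
have subG n : sval (G n) `<=` \bigcup_n sval (G n) by move=> x; exists n.
exists (\bigcup_n sval (G n)); split; first exact: (subG 0).
- by move=> /(proves_compact mG)[n]; case: (svalP (G n)).
- move=> phi; have [_ /(_ phi erefl)] := fP (form_code phi) (G (form_code phi)).
  rewrite -[f _ (G _)]/(G (form_code phi).+1) => -[GSphi|[nphi wit]].
    by left; exact: subG GSphi.
  right; split; first exact: proves_weaken (subG _) nphi.
  by move=> psi /wit[t tP]; exists t; exact: proves_weaken (subG _) tP.
Qed.

(** * Structures and the term model of a Henkin theory *)

Record structure := Structure {
  dom :> Type;
  zeroD : dom;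
  succD : dom -> dom;
  addD : dom -> dom -> dom;
  mulD : dom -> dom -> dom }.

Arguments zeroD {s}.

Fixpoint evalt (D : structure) (e : nat -> D) (t : tm) : D :=
  match t with
  | Var n => e n
  | Zero => zeroD
  | Succ t1 => succD (evalt e t1)
  | Add t1 t2 => addD (evalt e t1) (evalt e t2)
  | Mul t1 t2 => mulD (evalt e t1) (evalt e t2)
  end.

Fixpoint sat (D : structure) (e : nat -> D) (phi : form) : Prop :=
  match phi with
  | Bot => False
  | Eq t1 t2 => evalt e t1 = evalt e t2
  | Imp phi1 phi2 => sat e phi1 -> sat e phi2
  | All phi1 => forall x, sat (scons x e) phi1
  end.

Section TermModel.

Variable G : set form.
Hypotheses (conG : ~ proves G Bot) (decG : forall phi, decided G phi).

Let eqG t u := proves G (Eq t u).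

Let inst_shift t u : tm_subst (inst t) (tm_subst shift u) = u.
Proof. by rewrite tm_subst_comp (_ : _ \o shift = Var) ?tm_subst_var. Qed.

Let eqG_sym t u : eqG t u -> eqG u t.
Proof.
move=> p; have := @pr_eqE G t u (Eq (Var 0) (tm_subst shift t)) p.
by rewrite /= !inst_shift; apply; exact: pr_refl.
Qed.

Let eqG_trans t u v : eqG t u -> eqG u v -> eqG t v.
Proof.
move=> p q; have := @pr_eqE G u v (Eq (tm_subst shift t) (Var 0)) q.
by rewrite /= !inst_shift; exact.
Qed.

Let eqG_succ t u : eqG t u -> eqG (Succ t) (Succ u).
Proof.
move=> p; have := @pr_eqE G t u (Eq (Succ (tm_subst shift t)) (Succ (Var 0))) p.
by rewrite /= !inst_shift; apply; exact: pr_refl.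
Qed.

Let eqG_add t u t' u' : eqG t u -> eqG t' u' -> eqG (Add t t') (Add u u').
Proof.
move=> p q; apply: (@eqG_trans _ (Add u t')).
  have := @pr_eqE G t u
    (Eq (Add (tm_subst shift t) (tm_subst shift t')) (Add (Var 0) (tm_subst shift t'))) p.
  by rewrite /= !inst_shift; apply; exact: pr_refl.
have := @pr_eqE G t' u'
  (Eq (Add (tm_subst shift u) (tm_subst shift t')) (Add (tm_subst shift u) (Var 0))) q.
by rewrite /= !inst_shift; apply; exact: pr_refl.
Qed.

Let eqG_mul t u t' u' : eqG t u -> eqG t' u' -> eqG (Mul t t') (Mul u u').
Proof.
move=> p q; apply: (@eqG_trans _ (Mul u t')).
  have := @pr_eqE G t u
    (Eq (Mul (tm_subst shift t) (tm_subst shift t')) (Mul (Var 0) (tm_subst shift t'))) p.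
  by rewrite /= !inst_shift; apply; exact: pr_refl.
have := @pr_eqE G t' u'
  (Eq (Mul (tm_subst shift u) (tm_subst shift t')) (Mul (tm_subst shift u) (Var 0))) q.
by rewrite /= !inst_shift; apply; exact: pr_refl.
Qed.

(** Open terms count as elements too, since the Henkin witnesses are variables. *)
Let cls t : set tm := [set u | eqG t u].
Let el := {A : set tm | exists t, A = cls t}.
Let toel t : el := exist _ (cls t) (ex_intro _ t erefl).
Let rep (x : el) : tm := sval (cid (svalP x)).

Let toel_eq t u : toel t = toel u <-> eqG t u.
Proof.
split=> [[tu]|tu]; first by have : cls u u := pr_refl _ _; rewrite -tu.
apply: eq_exist; apply/seteqP; split=> v; last exact: eqG_trans.
by apply: eqG_trans; exact: eqG_sym.
Qed.

Let repK x : toel (rep x) = x.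
Proof.
by case: x => A xA; apply: eq_exist; rewrite /rep; case: cid => t /= ->.
Qed.

Let toelK t : eqG t (rep (toel t)).
Proof. by apply/toel_eq; rewrite repK. Qed.

Definition term_model : structure := @Structure el (toel Zero)
  (fun x => toel (Succ (rep x)))
  (fun x y => toel (Add (rep x) (rep y)))
  (fun x y => toel (Mul (rep x) (rep y))).

Let evalt_toel (s : nat -> tm) t :
  @evalt term_model (toel \o s) t = toel (tm_subst s t).
Proof.
elim: t => //= [t ->|t -> u ->|t -> u ->]; apply/toel_eq/eqG_sym.
- exact/eqG_succ/toelK.
- by apply: eqG_add; exact: toelK.
- by apply: eqG_mul; exact: toelK.
Qed.

Let thN phi : proves G phi -> ~ proves G (Neg phi).
Proof. by move=> p q; apply: conG; exact: pr_impE q p. Qed.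

Let thdec phi : proves G phi \/ proves G (Neg phi).
Proof. by case: (decG phi) => [Gphi|[]]; [left; exact: pr_hyp|right]. Qed.

(** The truth lemma. Implication uses that [G] decides every formula, generalization that a refuted
    universal formula has a refuted instance. *)
Let sat_toel (s : nat -> tm) phi :
  @sat term_model (toel \o s) phi <-> proves G (subst s phi).
Proof.
elim: phi s => [|t u|f IHf g IHg|f IHf] s /=.
- by split.
- by rewrite !evalt_toel toel_eq.
- rewrite IHf IHg; split=> [fg|]; last exact: pr_impE.
  have [/fg pg|nf] := thdec (subst s f).
    by apply: pr_impI; apply: proves_weaken pg; exact: subsetUr.
  apply/pr_impI/pr_raa/(@pr_impE _ (subst s f)); last by apply: pr_hyp; right; left.
  by apply: proves_weaken nf => x; right; right.
- have sub t : subst (scons t s) f = subst (inst t) (subst (up s) f).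
    by rewrite subst_comp; congr subst; apply/funext => -[|n] //=.
  have sat_t t : @sat term_model (scons (toel t) (toel \o s)) f <->
      proves G (subst (inst t) (subst (up s) f)).
    rewrite -sub -IHf (_ : scons _ _ = toel \o scons t s)//.
    by apply/funext => -[].
  split=> [all|p x]; last by rewrite -(repK x) sat_t; exact: pr_allE.
  case: (decG (All (subst (up s) f))) => [|[_ /(_ _ erefl)[t]]]; first exact: pr_hyp.
  by have /sat_t/thN := all (toel t).
Qed.

Lemma sat_term_model (e : nat -> term_model) phi :
  sentence phi -> (sat e phi <-> proves G phi).
Proof.
move=> sphi; rewrite (_ : e = toel \o (rep \o e)) ?sat_toel ?subst_sentence//.
by apply/funext => n /=; rewrite repK.
Qed.

End TermModel.

(** The Henkin theory proves no sentence outside [T], because [T] is complete and the Henkin theory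
    is consistent. *)
Lemma complete_extension_model T : complete_extension_of_PA T ->
  exists D : structure, forall (e : nat -> D) phi,
    sentence phi -> (sat e phi <-> T phi).
Proof.
move=> [sT _ conT complT].
have [G [TG conG decG]] := henkin_extension sT conT.
exists (term_model G) => e phi sphi; rewrite sat_term_model//.
split=> [p|/TG]; last exact: pr_hyp.
have [//|/TG nphi] := complT _ sphi; case: conG.
by apply: pr_impE p; exact: pr_hyp.
Qed.

(** * Arithmetic in a model of PA *)

Definition And phi psi := Neg (Imp phi (Neg psi)).
Definition Iff phi psi := And (Imp phi psi) (Imp psi phi).
Definition Ex phi := Neg (All (Neg phi)).

Fixpoint numeral (n : nat) : tm := if n is m.+1 then Succ (numeral m) else Zero.

Lemma numeral_bounded k n : tm_bounded k (numeral n).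
Proof. by elim: n. Qed.

Definition ltF (t u : tm) : form :=
  Ex (Eq (Add (tm_subst shift t) (Succ (Var 0))) (tm_subst shift u)).

(* Goedel's coding of finite sets: [x] is in the set coded by [(p, q)]
   when [1 + (x + 1) * q] divides [p]. *)
Definition memF (t p q : tm) : form :=
  Ex (Eq (tm_subst shift p)
         (Mul (Var 0) (Succ (Mul (Succ (tm_subst shift t)) (tm_subst shift q))))).

Section Sat.

Variable D : structure.
Implicit Types (e : nat -> D) (x y : D).

Definition ltD x y := exists z, addD x (succD z) = y.

Definition num (n : nat) : D := iter n (@succD D) zeroD.

Definition memD x p q := exists r, p = mulD r (succD (mulD (succD x) q)).

Lemma evalt_subst e s t : evalt e (tm_subst s t) = evalt (evalt e \o s) t.
Proof. by elim: t => //= [t ->|t -> u ->|t -> u ->]. Qed.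

Lemma evalt_shift e x t : evalt (scons x e) (tm_subst shift t) = evalt e t.
Proof. by rewrite evalt_subst. Qed.

Lemma sat_subst e s phi : sat e (subst s phi) <-> sat (evalt e \o s) phi.
Proof.
elim: phi e s => [|t u|f IHf g IHg|f IHf] e s //=.
- by rewrite !evalt_subst.
- by rewrite IHf IHg.
- have scE x : evalt (scons x e) \o up s = scons x (evalt e \o s).
    by apply/funext => -[|n] //=; rewrite evalt_shift.
  by split=> fP x; have := fP x; rewrite IHf scE.
Qed.

Lemma eq_evalt_bounded n e e' t : tm_bounded n t ->
  (forall i, i < n -> e i = e' i) -> evalt e t = evalt e' t.
Proof.
move=> + ee'; elim: t => //= [t IHt /IHt->//|t IHt u IHu|t IHt u IHu];
  by move=> /andP[/IHt-> /IHu->].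
Qed.

Lemma eq_sat_bounded n e e' phi : bounded n phi ->
  (forall i, i < n -> e i = e' i) -> sat e phi <-> sat e' phi.
Proof.
elim: phi n e e' => //= [t u|f IHf g IHg|f IHf] n e e'.
- move=> /andP[bt bu] ee'.
  by rewrite (eq_evalt_bounded bt ee') (eq_evalt_bounded bu ee').
- by move=> /andP[bf bg] ee'; rewrite (IHf n e e')// (IHg n e e').
- move=> bf ee'; split=> fP x; have := fP x;
  by rewrite (IHf n.+1 (scons x e) (scons x e'))// => -[|i] //= /ee'.
Qed.

Lemma sat_All e phi : sat e (All phi) <-> forall x, sat (scons x e) phi.
Proof. by []. Qed.

Lemma sat_Imp e phi psi : sat e (Imp phi psi) <-> (sat e phi -> sat e psi).
Proof. by []. Qed.

Lemma sat_Neg e phi : sat e (Neg phi) <-> ~ sat e phi.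
Proof. by []. Qed.

Lemma sat_And e phi psi : sat e (And phi psi) <-> sat e phi /\ sat e psi.
Proof.
split=> /= [h|[a b] h]; last exact: h.
by split; apply: contrapT => n; apply: h.
Qed.

Lemma sat_Iff e phi psi : sat e (Iff phi psi) <-> (sat e phi <-> sat e psi).
Proof. by rewrite sat_And; split=> [[]|[]]. Qed.

Lemma sat_Ex e phi : sat e (Ex phi) <-> exists x, sat (scons x e) phi.
Proof.
split=> /= [h|[x ex] h]; last exact: h ex.
by apply: contrapT => n; apply: h => x ex; apply: n; exists x.
Qed.

Lemma sat_ltF e t u : sat e (ltF t u) <-> ltD (evalt e t) (evalt e u).
Proof.
rewrite sat_Ex; split=> -[x xP]; exists x; move: xP => /=;
  by rewrite !evalt_shift.
Qed.

Lemma sat_memF e t p q :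
  sat e (memF t p q) <-> memD (evalt e t) (evalt e p) (evalt e q).
Proof.
rewrite sat_Ex; split=> -[x xP]; exists x; move: xP => /=;
  by rewrite !evalt_shift.
Qed.

Lemma sat_iter_All n e phi : sat e (iter n All phi) ->
  forall e', (forall i, e' (n + i) = e i) -> sat e' phi.
Proof.
elim: n e => [|n IHn] e /= h e' ee'; first by rewrite (_ : e' = e)//; apply/funext.
apply: (IHn _ (h (e' n))) => -[|i] /=; first by rewrite addn0.
by rewrite addnS -ee'.
Qed.

End Sat.

Arguments num {D} n.

Lemma bounded_iter_All k n phi : bounded k (iter n All phi) = bounded (n + k) phi.
Proof. by elim: n k => //= n IHn k; rewrite IHn addnS. Qed.

(** * Codes of finite sets and the standard numbers of a model *)

Fixpoint evalN (nu : nat -> nat) (t : tm) : nat :=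
  match t with
  | Var n => nu n
  | Zero => 0
  | Succ t1 => (evalN nu t1).+1
  | Add t1 t2 => evalN nu t1 + evalN nu t2
  | Mul t1 t2 => evalN nu t1 * evalN nu t2
  end.

Lemma evalN_numeral nu n : evalN nu (numeral n) = n.
Proof. by elim: n => //= n ->. Qed.

Lemma beta_code (Y : nat -> Prop) N :
  exists p q, forall i, i < N -> ((i.+1 * q).+1 %| p) <-> Y i.
Proof.
(* The factors are pairwise coprime, so the others do not divide the product. *)
exists (\prod_(i < N | `[< Y i >]) (i.+1 * N`!).+1), N`! => i iN.
have copS m q : coprime (m * q).+1 q by rewrite /coprime -addn1 gcdnC gcdnMDl gcdn1.
have cop j k : j < k -> k < N -> coprime (j.+1 * N`!).+1 (k.+1 * N`!).+1.
  move=> jk kN.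
  (* It remains to see that $(k-j)N!$ is prime to $(j+1)N!+1$: the latter is prime to $N!$, and
     $k-j$ divides $N!$. *)
  have -> : (k.+1 * N`!).+1 = (k - j) * N`! + (j.+1 * N`!).+1 by nia.
  rewrite /coprime gcdnDr -/(coprime _ _) coprimeMr copS andbT.
  apply: (coprime_dvdr _ (copS j.+1 N`!)).
  by apply: dvdn_fact; lia.
split=> [|Yi]; last first.
  by rewrite (bigD1 (Ordinal iN)) ?dvdn_mulr//=; exact/asboolP.
move=> dvd; apply: contrapT => nYi.
have : coprime (i.+1 * N`!).+1 (\prod_(i < N | `[< Y i >]) (i.+1 * N`!).+1).
  elim/big_ind: _ => [|x y cx cy|k /asboolP Yk]; rewrite ?coprimen1 ?coprimeMr ?cx//.
  have [ik|ki|ik] := ltngtP i k; [exact: cop|by rewrite coprime_sym; exact: cop|].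
  by rewrite ik in nYi.
rewrite /coprime (gcdn_idPl dvd) eqSS => /eqP.
have := fact_gt0 N; nia.
Qed.

Section Arithmetic.

Variable D : structure.
Hypothesis satPA : forall phi, peano phi -> forall e : nat -> D, sat e phi.
Implicit Types (e : nat -> D) (x y : D).

(** The environment [e] supplies the parameters: the axiom is closed by [n] quantifiers, where [n]
    bounds the free variables of [phi], and these are instantiated by [e]. *)
Lemma sat_ind phi e : sat (scons zeroD e) phi ->
  (forall x, sat (scons x e) phi -> sat (scons (succD x) e) phi) ->
  forall x, sat (scons x e) phi.
Proof.
move=> h0 hS; have [n bphi] := bounded_ex phi.
have bphiS : bounded n.+1 phi by exact: bounded_le bphi.
have ind : peano (iter n All (induction_for phi)).
  apply: PA_ind; rewrite /sentence bounded_iter_All addn0 /= bphiS andbT.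
  apply/andP; split; by apply: (bounded_subst bphiS) => -[|i].
have /= := sat_iter_All (satPA ind (fun i => e (n + i))) (fun i => erefl (e (n + i))).
apply.
  rewrite sat_subst (_ : _ \o _ = scons zeroD e)//; first by apply/funext => -[].
move=> x /hS; rewrite sat_subst (_ : evalt _ \o _ = scons (succD x) e)//.
by apply/funext => -[].
Qed.

Let e0 : nat -> D := fun=> zeroD.

Lemma succD_neq0 x : succD x <> zeroD.
Proof. exact: (satPA PA_succ_neq0 e0 x). Qed.

Lemma succD_inj x y : succD x = succD y -> x = y.
Proof. exact: (satPA PA_succ_inj e0 x y). Qed.

Lemma addD0 x : addD x zeroD = x.
Proof. exact: (satPA PA_add0 e0 x). Qed.

Lemma addDS x y : addD x (succD y) = succD (addD x y).
Proof. exact: (satPA PA_addS e0 x y). Qed.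

Lemma mulD0 x : mulD x zeroD = zeroD.
Proof. exact: (satPA PA_mul0 e0 x). Qed.

Lemma mulDS x y : mulD x (succD y) = addD (mulD x y) x.
Proof. exact: (satPA PA_mulS e0 x y). Qed.

Lemma zero_or_succD x : x = zeroD \/ exists y, x = succD y.
Proof.
have [->|nx] := pselect (x = zeroD); [by left|right].
pose phi := Imp (Neg (Eq (Var 0) Zero)) (Ex (Eq (Var 1) (Succ (Var 0)))).
have phiE y : sat (scons y e0) phi <-> (y <> zeroD -> exists z, y = succD z).
  have exE := @sat_Ex D (scons y e0) (Eq (Var 1) (Succ (Var 0))).
  by split=> h /h /exE.
have /phiE/(_ nx) // : sat (scons x e0) phi.
apply: sat_ind => [|y _]; apply/phiE => //= _; by exists y.
Qed.

Lemma add0D x : addD zeroD x = x.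
Proof.
apply: (@sat_ind (Eq (Add Zero (Var 0)) (Var 0)) e0) => /= [|{}x IH].
  by rewrite addD0.
by rewrite addDS IH.
Qed.

Lemma addSD x y : addD (succD x) y = succD (addD x y).
Proof.
apply: (@sat_ind (Eq (Add (Succ (Var 1)) (Var 0)) (Succ (Add (Var 1) (Var 0))))
  (scons x e0)) => /= [|z IH]; first by rewrite !addD0.
by rewrite !addDS IH.
Qed.

Lemma addDA x y z : addD x (addD y z) = addD (addD x y) z.
Proof.
apply: (@sat_ind (Eq (Add (Var 1) (Add (Var 2) (Var 0)))
                     (Add (Add (Var 1) (Var 2)) (Var 0)))
  (scons x (scons y e0))) => /= [|t IH]; first by rewrite !addD0.
by rewrite !addDS IH.
Qed.

(** Induction on [y], with the disjunction written as an implication. It serves to take the larger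
    of two bounds. *)
Lemma addD_total x y : (exists z, addD x z = y) \/ (exists z, addD y z = x).
Proof.
pose le i j := Ex (Eq (Add (Var i.+1) (Var 0)) (Var j.+1)).
have sat_le e i j : sat e (le i j) <-> exists z, addD (e i) z = e j by rewrite sat_Ex.
pose phi := Imp (Neg (le 1 0)) (le 0 1).
have phiE z : sat (scons z (scons x e0)) phi <->
    (~ (exists t, addD x t = z) -> exists t, addD z t = x).
  split=> h nxz.
    by apply/(sat_le (scons z (scons x e0)) 0 1)/h => /sat_le.
  by apply/sat_le/h => xz; apply/nxz/sat_le.
have /phiE h : sat (scons y (scons x e0)) phi.
  apply: sat_ind => [|z /phiE IH]; apply/phiE => nxz.
    by exists x; rewrite add0D.
  have {IH} /IH[t] : ~ exists t, addD x t = z.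
    by move=> [t tP]; apply: nxz; exists (succD t); rewrite addDS tP.
  have [->|[w ->]] := zero_or_succD t.
    rewrite addD0 => zx; case: nxz; exists (succD zeroD).
    by rewrite addDS addD0 zx.
  by rewrite addDS => <-; exists w; rewrite addSD.
by have [?|/h] := pselect (exists z, addD x z = y); [left|right].
Qed.

Lemma ltD_max x y : exists m,
  (m = x \/ m = y) /\ forall z, ltD z x \/ ltD z y -> ltD z m.
Proof.
wlog [w xw] : x y / exists z, addD x z = y.
  move=> wl; case: (addD_total x y) => [/wl//|/wl[m [mP mlt]]].
  by exists m; split; [rewrite or_comm|move=> z; rewrite or_comm; exact: mlt].
exists y; split; [by right|move=> z [[t tx]|//]].
by exists (addD t w); rewrite -xw -tx -addSD addDA.
Qed.

Lemma num_inj : injective (@num D).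
Proof.
elim=> [|m IH] [|n] //= e; last by rewrite (IH _ (succD_inj e)).
  by case: (succD_neq0 (esym e)).
by case: (succD_neq0 e).
Qed.

Lemma addD_num m n : addD (num m) (num n) = num (m + n) :> D.
Proof. by elim: n => [|n IH]; rewrite ?addn0 /= ?addD0// addDS IH addnS. Qed.

Lemma mulD_num m n : mulD (num m) (num n) = num (m * n) :> D.
Proof.
by elim: n => [|n IH]; rewrite ?muln0 /= ?mulD0// mulDS IH addD_num mulnSr.
Qed.

Lemma evalt_num nu t : evalt (@num D \o nu) t = num (evalN nu t).
Proof. by elim: t => //= [t ->|t -> u ->|t -> u ->]; rewrite ?addD_num ?mulD_num. Qed.

Lemma evalt_numeral e n : evalt e (numeral n) = num n.
Proof. by elim: n => //= n ->. Qed.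

(** This makes the standard numbers an initial segment of [D]. *)
Lemma addD_eq_num x y n : addD x y = num n ->
  exists i j, [/\ x = num i, y = num j & i + j = n].
Proof.
elim: n y => [|n IH] y; have [->|[z ->]] := zero_or_succD y;
  rewrite ?addD0 ?addDS => xy.
- by exists 0, 0.
- by case: (succD_neq0 xy).
- by exists n.+1, 0; rewrite addn0.
- have [i [j [-> -> <-]]] := IH _ (succD_inj xy).
  by exists i, j.+1; rewrite addnS.
Qed.

Lemma ltD_num x n : ltD x (num n) <-> exists2 i, i < n & x = num i.
Proof.
split=> [[z /addD_eq_num[i [[|j] [xi zj <-]]]]|[i i_n ->]].
- by case: (succD_neq0 zj).
- by exists i => //; rewrite addnS ltnS leq_addr.
- by exists (num (n - i.+1)); rewrite -[succD _]/(num _.+1) addD_num; congr num; lia.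
Qed.

Lemma memD_num i p q : @memD D (num i) (num p) (num q) <-> (i.+1 * q).+1 %| p.
Proof.
rewrite /memD -[succD (num i)]/(num i.+1) mulD_num -[succD (num _)]/(num _.+1).
split=> [[r]|/dvdnP[r ->]]; last by exists (num r); rewrite mulD_num.
(* The quotient [r] might be nonstandard; it is not, being a summand of the standard number [p]. *)
rewrite [num _.+1]/= mulDS => /esym /[dup] /addD_eq_num [_ [j [_ -> _]]].
by rewrite -mulDS -[succD _]/(num _.+1) mulD_num => /num_inj<-; exact: dvdn_mull.
Qed.

Lemma memD_code (Y : nat -> Prop) N :
  exists p q : D, forall i, i < N -> memD (num i) p q <-> Y i.
Proof.
have [p [q pq]] := beta_code Y N; exists (num p), (num q) => i iN.
by rewrite memD_num pq.
Qed.

End Arithmetic.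

(** * A basis theorem for the sets represented in a model of PA *)

(** [KForm] admits formulas that do not mention [Y]; through it a set that is already represented
    enters the condition on the next one. *)
Inductive qfcon : Type :=
| KIn of tm | KEq of tm & tm | KForm of form | KBot
| KImp of qfcon & qfcon | KAnd of qfcon & qfcon.

(* Universal conditions on a set [Y]: [KIn t] says that [t] belongs to [Y]. *)
Inductive con : Type := KQf of qfcon | KAll of con.

Fixpoint qf_bounded n k : bool :=
  match k with
  | KIn t => tm_bounded n t
  | KEq t u => tm_bounded n t && tm_bounded n u
  | KForm phi => bounded n phi
  | KBot => true
  | KImp k1 k2 | KAnd k1 k2 => qf_bounded n k1 && qf_bounded n k2
  end.

Fixpoint con_bounded n c : bool :=
  match c with KQf k => qf_bounded n k | KAll c1 => con_bounded n.+1 c1 end.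

Section Con.

Variable D : structure.

Fixpoint qf_sat (Y : D -> Prop) (e : nat -> D) (k : qfcon) : Prop :=
  match k with
  | KIn t => Y (evalt e t)
  | KEq t u => evalt e t = evalt e u
  | KForm phi => sat e phi
  | KBot => False
  | KImp k1 k2 => qf_sat Y e k1 -> qf_sat Y e k2
  | KAnd k1 k2 => qf_sat Y e k1 /\ qf_sat Y e k2
  end.

(** With [B] the elements below some [b], this is expressible in arithmetic for coded sets [Y]. *)
Fixpoint con_sat (Y B : D -> Prop) (e : nat -> D) (c : con) : Prop :=
  match c with
  | KQf k => qf_sat Y e k
  | KAll c1 => forall x, B x -> con_sat Y B (scons x e) c1
  end.

Fixpoint qf_true (Y : nat -> Prop) (nu : nat -> nat) (k : qfcon) : Prop :=
  match k with
  | KIn t => Y (evalN nu t)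
  | KEq t u => evalN nu t = evalN nu u
  | KForm phi => sat (@num D \o nu) phi
  | KBot => False
  | KImp k1 k2 => qf_true Y nu k1 -> qf_true Y nu k2
  | KAnd k1 k2 => qf_true Y nu k1 /\ qf_true Y nu k2
  end.

Fixpoint con_true (Y : nat -> Prop) (nu : nat -> nat) (c : con) : Prop :=
  match c with
  | KQf k => qf_true Y nu k
  | KAll c1 => forall n, con_true Y (scons n nu) c1
  end.

(** For a given [n] the right side amounts to the truth of one sentence in [D]. *)
Definition represented (X : set nat) := exists phi, bounded 1 phi /\
  forall (e : nat -> D) n, X n <-> sat (scons (num n) e) phi.

End Con.

Fixpoint qf_form (p q : nat) (k : qfcon) : form :=
  match k with
  | KIn t => memF t (Var p) (Var q)
  | KEq t u => Eq t u
  | KForm phi => phi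
  | KBot => Bot
  | KImp k1 k2 => Imp (qf_form p q k1) (qf_form p q k2)
  | KAnd k1 k2 => And (qf_form p q k1) (qf_form p q k2)
  end.

Fixpoint con_form (p q b : nat) (c : con) : form :=
  match c with
  | KQf k => qf_form p q k
  | KAll c1 => All (Imp (ltF (Var 0) (Var b.+1)) (con_form p.+1 q.+1 b.+1 c1))
  end.

Lemma qf_form_bounded m n p q k : qf_bounded n k -> n <= m -> p < m -> q < m ->
  bounded m (qf_form p q k).
Proof.
move=> + nm pm qm; elim: k => //=.
- move=> t bt; rewrite !ltnS pm qm !andbT.
  by apply: (tm_bounded_subst bt) => i /leq_trans; exact.
- by move=> t u /andP[/(tm_bounded_le nm)-> /(tm_bounded_le nm)->].
- by move=> phi; exact: bounded_le.
- by move=> k1 IH1 k2 IH2 /andP[/IH1-> /IH2->].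
- by move=> k1 IH1 k2 IH2 /andP[/IH1-> /IH2->].
Qed.

Lemma con_form_bounded m n p q b c : con_bounded n c -> n <= m -> p < m ->
  q < m -> b < m -> bounded m (con_form p q b c).
Proof.
elim: c m n p q b => [k|c IH] m n p q b /=.
  by move=> bk nm pm qm _; exact: qf_form_bounded bk nm pm qm.
by move=> bc nm pm qm bm; rewrite !ltnS bm (IH _ n.+1).
Qed.

Lemma forall_iff T (P Q : T -> Prop) : (forall x, P x <-> Q x) ->
  (forall x, P x) <-> (forall x, Q x).
Proof. by move=> PQ; split=> h x; exact/PQ. Qed.

Lemma exists_iff T (P Q : T -> Prop) : (forall x, P x <-> Q x) ->
  (exists x, P x) <-> (exists x, Q x).
Proof. by move=> PQ; split=> -[x Px]; exists x; exact/PQ. Qed.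

Lemma sat_con_form (D : structure) (e : nat -> D) p q b c : sat e (con_form p q b c) <->
  con_sat (fun x => memD x (e p) (e q)) (fun x => ltD x (e b)) e c.
Proof.
elim: c e p q b => [k|c IH] e p q b; last first.
  by rewrite sat_All; apply: forall_iff => x; rewrite sat_Imp sat_ltF IH.
rewrite /con_form /con_sat.
elim: k => // [t|k1 IH1 k2 IH2|k1 IH1 k2 IH2].
- exact: sat_memF.
- by rewrite sat_Imp IH1 IH2.
- by rewrite sat_And IH1 IH2.
Qed.

Lemma eq_con_sat_bounded (D : structure) (Y B : D -> Prop) n (e e' : nat -> D) c :
  con_bounded n c ->
  (forall i, i < n -> e i = e' i) -> con_sat Y B e c <-> con_sat Y B e' c.
Proof.
elim: c n e e' => [k|c IH] n e e' /=; last first.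
  move=> bc ee'; apply: forall_iff => x.
  by rewrite (IH n.+1 _ (scons x e'))// => -[|i] //= /ee'.
move=> + ee'; elim: k => //= [t bt|t u|phi bp|k1 IH1 k2 IH2|k1 IH1 k2 IH2].
- by rewrite (eq_evalt_bounded bt ee').
- by move=> /andP[bt bu]; rewrite (eq_evalt_bounded bt ee') (eq_evalt_bounded bu ee').
- exact: eq_sat_bounded ee'.
- by move=> /andP[/IH1-> /IH2->].
- by move=> /andP[/IH1-> /IH2->].
Qed.

Lemma con_sat_sub (D : structure) (Y B B' : D -> Prop) e c : (forall x, B' x -> B x) ->
  con_sat Y B e c -> con_sat Y B' e c.
Proof.
move=> BB'; elim: c e => //= c IH e h x /BB' /h; exact: IH.
Qed.

(** * The leftmost path inside the model *)

Section Path.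

Variables (D : structure) (c : con).
Hypothesis satPA : forall phi, peano phi -> forall e : nat -> D, sat e phi.
Hypothesis bc : con_bounded 0 c.
Implicit Types (b p q x : D).

Let e0 : nat -> D := fun=> zeroD.

Let Good b p q := con_sat (fun x => memD x p q) (fun x => ltD x b) e0 c.

Let agree n p q p' q' := forall x, ltD x n -> (memD x p' q' <-> memD x p q).

(* The part below [n] of the set coded by [(p, q)] extends to good sets that
   omit [n]. Only the [b] with good sets matter: they include the standard ones,
   but they may be bounded in [D]. *)
Let Ext0 n p q := forall b, (exists q' p', Good b p' q') ->
  exists q' p', Good b p' q' /\ (agree n p q p' q' /\ ~ memD n p' q').

(* [(p, q)] codes below [n] the leftmost path. *)
Let Left n p q := forall x, ltD x n -> (memD x p q <-> ~ Ext0 x p q).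

Let goodF := con_form 0 1 2 c.

Let ext0F (n p q : nat) :=
  All (Imp (Ex (Ex goodF))
    (Ex (Ex (And goodF
      (And (All (Imp (ltF (Var 0) (Var n.+4))
                  (Iff (memF (Var 0) (Var 1) (Var 2))
                       (memF (Var 0) (Var p.+4) (Var q.+4)))))
           (Neg (memF (Var n.+3) (Var 0) (Var 1)))))))).

Let leftF (n p q : nat) :=
  All (Imp (ltF (Var 0) (Var n.+1))
    (Iff (memF (Var 0) (Var p.+1) (Var q.+1)) (Neg (ext0F 0 p.+1 q.+1)))).

Let pathF := Ex (Ex (And (leftF 2 0 1) (Neg (ext0F 2 0 1)))).

Let Path n := exists q p, Left n p q /\ ~ Ext0 n p q.

Let sat_goodF e : sat e goodF <-> Good (e 2) (e 0) (e 1).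
Proof. by rewrite sat_con_form; exact: eq_con_sat_bounded bc _. Qed.

Let sat_ext0F e (n p q : nat) : sat e (ext0F n p q) <-> Ext0 (e n) (e p) (e q).
Proof.
rewrite sat_All; apply: forall_iff => b; rewrite sat_Imp.
have -> : sat (scons b e) (Ex (Ex goodF)) <-> exists q' p', Good b p' q'.
  rewrite sat_Ex; apply: exists_iff => q'; rewrite sat_Ex.
  by apply: exists_iff => p'; rewrite sat_goodF.
apply: imp_iff_compat_l; rewrite sat_Ex; apply: exists_iff => q'.
rewrite sat_Ex; apply: exists_iff => p'; rewrite !sat_And sat_goodF.
apply: and_iff_compat_l; rewrite sat_Neg sat_memF; apply: and_iff_compat_r.
rewrite sat_All; apply: forall_iff => x.
by rewrite sat_Imp sat_ltF sat_Iff !sat_memF.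
Qed.

Let sat_leftF e (n p q : nat) : sat e (leftF n p q) <-> Left (e n) (e p) (e q).
Proof.
rewrite sat_All; apply: forall_iff => x.
by rewrite sat_Imp sat_ltF sat_Iff sat_memF sat_Neg sat_ext0F.
Qed.

Let sat_pathF e : sat e pathF <-> Path (e 0).
Proof.
rewrite sat_Ex; apply: exists_iff => q; rewrite sat_Ex; apply: exists_iff => p.
by rewrite sat_And sat_Neg sat_leftF sat_ext0F.
Qed.

Let bounded_pathF : bounded 1 pathF.
Proof.
have bgood k : bounded k.+3 goodF by exact: con_form_bounded bc _ _ _ _.
by rewrite /pathF /leftF /ext0F /= !bgood.
Qed.

Let std_agree (n : nat) (Y : nat -> Prop) p q :=
  forall i, i < n -> memD (num i) p q <-> Y i.

Let Y n := Path (num n).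

Let Ext0_agree n p q p' q' : agree n p q p' q' -> Ext0 n p q -> Ext0 n p' q'.
Proof.
move=> ag ext b /ext [r [s [Gb [ag' nn]]]]; exists r, s; split=> //.
by split=> // x xn; rewrite (ag' x xn) (ag x xn).
Qed.

Let std_agree_agree (n : nat) Z p q p' q' :
  std_agree n Z p q -> std_agree n Z p' q' -> agree (num n) p q p' q'.
Proof.
by move=> h h' x /(ltD_num satPA)[i i_n ->]; rewrite h// h'.
Qed.

Let Left_le i n p q : i <= n -> Left (num n) p q -> Left (num i) p q.
Proof.
move=> i_n h x /(ltD_num satPA)[j ji ->]; apply: h.
by apply/(ltD_num satPA); exists j => //; exact: leq_trans i_n.
Qed.

(** Leftmost codes are unique below a standard number, since membership of [i] depends only on the
    part below [i]. *)
Let Left_std_agree n p q : Left (num n) p q -> std_agree n Y p q.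
Proof.
suff h i : forall n p q, i < n -> Left (num n) p q -> (memD (num i) p q <-> Y i).
  by move=> L i i_n; exact: h i_n L.
elim/ltn_ind: i => i IH {}n {}p {}q i_n L.
have ag r s : Left (num i) r s -> std_agree i Y r s.
  by move=> L' j ji; exact: IH L'.
have Li := Left_le (ltnW i_n) L.
rewrite L; last by apply/(ltD_num satPA); exists i.
split=> [next|[r [s [L' next]]]]; first by exists q, p.
move=> ext; apply: next; apply: Ext0_agree ext.
by apply: std_agree_agree (ag _ _ Li) (ag _ _ L').
Qed.

(** No induction inside [D] is needed: below a standard [n], the set [Y] itself has a code. *)
Let Left_ex n : exists p q, Left (num n) p q.
Proof.
elim/ltn_ind: n => n IH.
have [p [q pq]] := memD_code satPA Y n; exists p, q.
move=> _ /(ltD_num satPA)[i i_n ->]; rewrite pq//.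
have [p' [q' L']] := IH _ i_n.
have ag : std_agree i Y p q by move=> j ji; apply: pq; exact: ltn_trans i_n.
split=> [[s [r [L next]]]|next].
  move=> ext; apply: next; apply: Ext0_agree ext.
  by apply: std_agree_agree ag _; exact: Left_std_agree.
exists q', p'; split=> // ext; apply: next; apply: Ext0_agree ext.
by apply: std_agree_agree ag; exact: Left_std_agree.
Qed.

Let Good_le b b' p q : (forall x, ltD x b -> ltD x b') -> Good b' p q -> Good b p q.
Proof. by move=> bb'; apply: con_sat_sub. Qed.

(** If the path can omit [n], then [Ext0] gives the set at once. Otherwise some bound [b1] has good
    sets, but none that follows the path and omits [n]; so a good set along the path for the larger
    of [b] and [b1] contains [n]. Such sets exist, as the larger bound is again [b] or [b1]. *)
Let Good_extend n b : (exists q p, Good b p q) ->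
  exists q p, Good b p q /\ std_agree n Y p q.
Proof.
elim: n b => [|n IH] b exb; first by case: exb => q [p pq]; exists q, p.
have [p [q L]] := Left_ex n.
have agL := Left_std_agree L.
have step p' q' : std_agree n Y p' q' -> (memD (num n) p' q' <-> Y n) ->
    std_agree n.+1 Y p' q'.
  by move=> h h' i; rewrite ltnS leq_eqVlt => /orP[/eqP->|/h].
have [Yn|nYn] := pselect (Y n); last first.
  have ext : Ext0 (num n) p q by apply: contrapT => next; apply: nYn; exists q, p.
  have [q' [p' [Gb [ag nn]]]] := ext b exb; exists q', p'; split=> //.
  apply: step => // i i_n; rewrite ag ?agL//.
  by apply/(ltD_num satPA); exists i.
have [q1 [p1 [L1 /existsNP[b1 /not_implyP[ex1 none]]]]] := Yn.
have [m [mE mlt]] := ltD_max satPA b b1.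
have [|q' [p' [Gm ag]]] := IH m; first by case: mE => ->.
exists q', p'; split; first by apply: Good_le Gm => x xb; apply: mlt; left.
apply: step => //; split=> // _; apply: contrapT => nn; apply: none.
exists q', p'; split; first by apply: Good_le Gm => x xb; apply: mlt; right.
by split=> //; apply: std_agree_agree ag; exact: Left_std_agree.
Qed.

(** At given arguments the matrix consults the set at finitely many numbers only. *)
Let qf_sat_true Z nu k : exists n, forall p q, std_agree n Z p q ->
  qf_sat (fun x => memD x p q) (num \o nu) k <-> qf_true D Z nu k.
Proof.
elim: k => /= [t|t u|phi||k1 [n1 IH1] k2 [n2 IH2]|k1 [n1 IH1] k2 [n2 IH2]].
- exists (evalN nu t).+1 => p q pq; rewrite (evalt_num satPA); exact: pq.
- exists 0 => p q _; rewrite !(evalt_num satPA).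
  by split=> [/(num_inj satPA)|->].
- by exists 0.
- by exists 0.
- exists (maxn n1 n2) => p q pq; rewrite IH1 ?IH2// => i i_n; apply: pq.
    by rewrite leq_max i_n orbT.
  by rewrite leq_max i_n.
- exists (maxn n1 n2) => p q pq; rewrite IH1 ?IH2// => i i_n; apply: pq.
    by rewrite leq_max i_n orbT.
  by rewrite leq_max i_n.
Qed.

Let con_true_sat Z nu (b : nat) d : con_true D Z nu d -> exists n, forall p q,
  std_agree n Z p q ->
  con_sat (fun x => memD x p q) (fun x => ltD x (num b)) (num \o nu) d.
Proof.
elim: d nu => [k|d IH] nu /=.
  by have [n nP] := qf_sat_true Z nu k; exists n => p q /nP ->.
move=> h; have [f fP] := choice (fun m => IH (scons m nu) (h m)).
(* A standard bound leaves finitely many instances, so the largest of their requirements is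
   enough. *)
exists (\max_(m < b) f m) => p q pq _ /(ltD_num satPA)[m mb ->].
have -> : scons (num m) (num \o nu) = @num D \o scons m nu by apply/funext => -[].
apply: fP => i i_n; apply: pq; apply: leq_trans i_n _.
exact: (leq_bigmax (Ordinal mb)).
Qed.

(** No single code has to satisfy the whole condition: each instance needs one code that agrees with
    [Z] far enough. *)
Let con_sat_true Z nu d :
  (forall b n : nat, exists q p, std_agree n Z p q /\
    con_sat (fun x => memD x p q) (fun x => ltD x (num b)) (num \o nu) d) ->
  con_true D Z nu d.
Proof.
elim: d nu => [k|d IH] nu /= h.
  have [n nP] := qf_sat_true Z nu k.
  by have [q [p [ag]]] := h 0 n; rewrite nP.
move=> m; apply: IH => b n.
(* The bound has to exceed [m] for the instance at [num m] to be covered. *)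
have [q [p [ag sP]]] := h (maxn b m.+1) n; exists q, p; split=> //.
have -> : @num D \o scons m nu = scons (num m) (num \o nu) by apply/funext => -[].
apply: con_sat_sub (sP (num m) _).
  move=> _ /(ltD_num satPA)[i ib ->]; apply/(ltD_num satPA).
  by exists i => //; rewrite leq_max ib.
by apply/(ltD_num satPA); exists m => //; rewrite leq_max leqnn orbT.
Qed.

(** [Z] may be arbitrarily complex: its initial segments only supply good sets for each standard
    bound, which keeps the leftmost path alive at every standard level. *)
Lemma represented_solution Z nu : con_true D Z nu c ->
  exists X, represented D X /\ con_true D X nu c.
Proof.
move=> Zc; have env (P B : D -> Prop) : con_sat P B (num \o nu) c <-> con_sat P B e0 c.
  exact: eq_con_sat_bounded bc _.
exists Y; split.
  by exists pathF; split=> // e n; rewrite sat_pathF.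
apply: con_sat_true => b n.
have [|q [p [Gb ag]]] := Good_extend n (b := num b).
  have [m mP] := con_true_sat b Zc; have [p [q pq]] := memD_code satPA Z m.
  by exists q, p; apply/env/mP.
by exists q, p; split=> //; apply/env.
Qed.

End Path.

(** * Represented sets are computable from the theory *)

Definition CId : code := CPair CFst CSnd.

Lemma eval_id A n : eval A CId n n.
Proof.
by have [a [b ->]] := pair_codeP n; apply: eval_pair; constructor.
Qed.

Definition CConst (m : nat) : code := iter m (CComp CSucc) CZero.

Lemma eval_const A m n : eval A (CConst m) n m.
Proof. by elim: m => [|m IH] /=; [|apply: eval_comp IH _]; constructor. Qed.

(** The recursion step receives parameter, counter and previous value; [CComp CSnd CSnd] extracts
    the value, and 2 is the tag of [Succ]. *)
Definition CNumeral : code :=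
  CComp (CPrec (CConst (tm_code Zero))
               (CPair (CConst 2) (CComp CSnd CSnd)))
        (CPair CZero CId).

Lemma eval_numeral A n : eval A CNumeral n (tm_code (numeral n)).
Proof.
apply: eval_comp; first by apply: eval_pair; [exact: eval_zero|exact: eval_id].
elim: n => [|n IH]; first by apply: eval_prec0; exact: eval_const.
apply: eval_precS IH _; apply: eval_pair; first exact: eval_const.
by apply: eval_comp; constructor.
Qed.

(** The sentence [forall x, x = n -> phi x] replaces [phi n], because its code is assembled without
    computing a substitution. *)
Definition CInstance (phi : form) : code :=
  CPair (CConst 3)
    (CPair (CConst 2)
      (CPair (CPair (CConst 1) (CPair (CConst (tm_code (Var 0))) CNumeral))
             (CConst (form_code phi)))).

Lemma eval_instance A phi n :
  eval A (CInstance phi) n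
    (form_code (All (Imp (Eq (Var 0) (numeral n)) phi))).
Proof.
by do 4?[apply: eval_pair]; do ?[exact: eval_const|exact: eval_numeral|apply: eval_pair].
Qed.

Lemma represented_turing_le T (D : structure) A X :
  (forall (e : nat -> D) phi, sentence phi -> (sat e phi <-> T phi)) ->
  turing_le [set form_code phi | phi in T] A ->
  represented D X -> turing_le X A.
Proof.
move=> DT [c cP] [phi [bphi phiX]]; exists (CComp c (CInstance phi)) => n.
set psi := All (Imp (Eq (Var 0) (numeral n)) phi).
have spsi : sentence psi by rewrite /sentence /= numeral_bounded.
have XT : X n <-> [set form_code phi | phi in T] (form_code psi).
  rewrite (phiX (fun=> zeroD)); split=> [h|[chi Tchi /form_code_inj chiE]].
    exists psi => //; apply/(DT (fun=> zeroD) _ spsi) => x /=.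
    by rewrite evalt_numeral => ->.
  have /(DT (fun=> zeroD) _ spsi) /= : T psi by rewrite -chiE.
  by apply; rewrite evalt_numeral.
have [c1 c0] := cP (form_code psi).
by split=> Xn; (apply: eval_comp; first exact: eval_instance);
  [apply/c1/XT|apply: c0; move/XT].
Qed.

(** * Words and groups *)

Definition gword : Type := seq (nat * bool).

Definition winv (w : gword) : gword := rev [seq (l.1, ~~ l.2) | l <- w].

Definition wshift k (w : gword) : gword := [seq (k + l.1, l.2) | l <- w].

Definition over n (w : gword) : bool := all (fun l => l.1 < n) w.

Definition wval (G : groupType) (h : nat -> G) (w : gword) : G :=
  (\prod_(l <- w) if l.2 then (h l.1)^-1 else h l.1)%g.

Section Wval.

Local Open Scope group_scope.
Variable G : groupType.
Implicit Types (h : nat -> G) (u v w : gword).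

Lemma wval_nil h : wval h [::] = 1.
Proof. exact: big_nil. Qed.

Lemma wval_cons h l w :
  wval h (l :: w) = (if l.2 then (h l.1)^-1 else h l.1) * wval h w.
Proof. exact: big_cons. Qed.

Lemma wval_cat h u v : wval h (u ++ v) = wval h u * wval h v.
Proof. exact: big_cat. Qed.

Lemma wval_gen h i : wval h [:: (i, false)] = h i.
Proof. exact: big_seq1. Qed.

Lemma wval_inv h w : wval h (winv w) = (wval h w)^-1.
Proof.
elim: w => [|l w IH]; first by rewrite wval_nil invg1.
rewrite wval_cons invgM -IH /winv /= rev_cons -cats1 wval_cat; congr (_ * _).
by rewrite wval_cons wval_nil mulg1 /=; case: l.2 => //=; rewrite invgK.
Qed.

Lemma wval_shift h k w : wval h (wshift k w) = wval (fun i => h (k + i)%N) w.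
Proof. by rewrite /wval big_map. Qed.

Lemma eq_wval_over n h h' w : over n w -> (forall i, (i < n)%N -> h i = h' i) ->
  wval h w = wval h' w.
Proof.
move=> + hh'; elim: w => [|l w IH]; first by rewrite !wval_nil.
by move=> /andP[/hh' hl /IH]; rewrite !wval_cons hl => ->.
Qed.

End Wval.

Lemma over_cat n u v : over n (u ++ v) = over n u && over n v.
Proof. exact: all_cat. Qed.

Lemma over_inv n w : over n (winv w) = over n w.
Proof. by rewrite /over all_rev all_map. Qed.

Lemma over_le m n w : m <= n -> over m w -> over n w.
Proof. by move=> mn; apply: sub_all => l; move=> /leq_trans; exact. Qed.

Lemma over_ex w : exists n, over n w.
Proof.
elim: w => [|l w [n wn]]; first by exists 0.
exists (maxn l.1.+1 n); rewrite /= leq_max ltnSn /=.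
by apply: over_le wn; exact: leq_maxr.
Qed.

(** * Groups as quotients of the words by a congruence *)

Record congruence := Congruence {
  crel :> gword -> gword -> Prop;
  crel_refl : forall u, crel u u;
  crel_sym : forall u v, crel u v -> crel v u;
  crel_trans : forall u v w, crel u v -> crel v w -> crel u w;
  crel_cat : forall u u' v v', crel u u' -> crel v v' -> crel (u ++ v) (u' ++ v');
  crel_cancel : forall i e, crel [:: (i, e); (i, ~~ e)] [::] }.

Section Quotient.

Variable c : congruence.

Let catVr w : c (w ++ winv w) [::].
Proof.
elim: w => [|[i e] w IH]; first exact: crel_refl.
rewrite /winv /= rev_cons -cats1 catA.
apply: crel_trans (crel_cancel c i e); rewrite -cat1s -[[:: _; _]]cat1s.
apply: crel_cat; first exact: crel_refl.
rewrite -[X in c _ X]cat0s; apply: crel_cat; last exact: crel_refl.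
exact: IH.
Qed.

Let winvK w : winv (winv w) = w.
Proof.
rewrite /winv map_rev revK -map_comp map_id_in// => -[i e] _ /=.
by rewrite negbK.
Qed.

Let catVl w : c (winv w ++ w) [::].
Proof. by rewrite -{2}(winvK w); exact: catVr. Qed.

(** Compatibility with inverses is not a field of the record, since cancellation forces it. *)
Let crel_inv u v : c u v -> c (winv u) (winv v).
Proof.
move=> uv; apply: (@crel_trans _ _ (winv u ++ (u ++ winv v))).
  rewrite -[X in c X _]cats0; apply: crel_cat; first exact: crel_refl.
  apply/crel_sym/(crel_trans _ (catVr v)).
  by apply: crel_cat => //; exact: crel_refl.
rewrite catA -[X in c _ X]cat0s; apply: crel_cat; last exact: crel_refl.
exact: catVl.
Qed.

Definition crep (w : gword) : gword := xget [::] [set v | c w v].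

Let crepP w : c w (crep w).
Proof. by apply: (@xgetPex _ [::] [set v | c w v]); exists w; exact: crel_refl. Qed.

Let crep_eq u v : c u v -> crep u = crep v.
Proof.
move=> uv; rewrite /crep; congr xget; apply/seteqP; split=> w.
  by apply: crel_trans; exact: crel_sym.
exact: crel_trans.
Qed.

Let crep_idem w : crep (crep w) == crep w.
Proof. by apply/eqP/crep_eq/crel_sym. Qed.

(** Words that are their own chosen representative: as a subtype of the words, the quotient inherits
    countability. *)
Definition quot : Type := {w : gword | crep w == w}.

HB.instance Definition _ := Choice.on quot.
HB.instance Definition _ := Countable.on quot.

Definition quot_of w : quot := exist _ (crep w) (crep_idem w).

Let quot_ofP u v : quot_of u = quot_of v <-> c u v.
Proof.
split=> [[uv]|uv]; last by apply: val_inj => /=; exact: crep_eq.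
by apply: crel_trans (crepP u) _; rewrite uv; exact: crel_sym.
Qed.

Let quot_ofK x : quot_of (val x) = x.
Proof. by apply: val_inj => /=; exact/eqP/(valP x). Qed.

Let val_quot_of w : c (val (quot_of w)) w.
Proof. exact/crel_sym/crepP. Qed.

Definition quot_mul (x y : quot) := quot_of (val x ++ val y).
Definition quot_one := quot_of [::].
Definition quot_inv (x : quot) := quot_of (winv (val x)).

Lemma quot_mulE u v : quot_mul (quot_of u) (quot_of v) = quot_of (u ++ v).
Proof. by apply/quot_ofP/crel_cat; exact: val_quot_of. Qed.

Lemma quot_invE u : quot_inv (quot_of u) = quot_of (winv u).
Proof. by apply/quot_ofP/crel_inv/val_quot_of. Qed.

Lemma quot_mulA : associative quot_mul.
Proof.
move=> x y z; rewrite -(quot_ofK x) -(quot_ofK y) -(quot_ofK z).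
by rewrite !quot_mulE catA.
Qed.

Lemma quot_mul1 : left_id quot_one quot_mul.
Proof. by move=> x; rewrite -(quot_ofK x) quot_mulE. Qed.

Lemma quot_1mul : right_id quot_one quot_mul.
Proof. by move=> x; rewrite -(quot_ofK x) quot_mulE cats0. Qed.

Lemma quot_mulV : left_inverse quot_one quot_inv quot_mul.
Proof.
by move=> x; rewrite -(quot_ofK x) quot_invE quot_mulE; apply/quot_ofP/catVl.
Qed.

Lemma quot_Vmul : right_inverse quot_one quot_inv quot_mul.
Proof.
by move=> x; rewrite -(quot_ofK x) quot_invE quot_mulE; apply/quot_ofP/catVr.
Qed.

HB.instance Definition _ := isGroup.Build quot
  quot_mulA quot_mul1 quot_1mul quot_mulV quot_Vmul.

Lemma congruence_group : exists (G : groupType) (h : nat -> G),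
  [/\ countable [set: G], forall u v, wval h u = wval h v <-> c u v
    & forall x, exists w, x = wval h w].
Proof.
pose h i : quot := quot_of [:: (i, false)].
have hE w : wval h w = quot_of w.
  elim: w => [|[i e] w IH]; first by rewrite wval_nil.
  rewrite wval_cons IH -[(i, e) :: w]cat1s -quot_mulE; congr (_ * _)%g.
  by case: e => //=; rewrite -[(h i)^-1%g]/(quot_inv _) quot_invE.
exists quot, h; split=> [|u v|x]; last by exists (val x); rewrite hE quot_ofK.
  exact: countableP.
by rewrite !hE quot_ofP.
Qed.

End Quotient.

(** * Coding words by numbers *)

Definition lcode (l : nat * bool) : nat := l.1.*2 + l.2.

Definition gcode (w : gword) : nat :=
  foldr (fun l c => (pair_code (lcode l) c).+1) 0 w.

Lemma lcode_surj l : lcode (l./2, odd l) = l.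
Proof. by rewrite /lcode addnC odd_double_half. Qed.

Lemma lcode_inj : injective lcode.
Proof.
move=> [i e] [j f]; rewrite /lcode /= => ij; congr pair; last first.
  by have := congr1 odd ij; rewrite !oddD !odd_double !oddb.
by case: e f ij => -[]; lia.
Qed.

Lemma lcode_lt l n : (lcode l < n.*2) = (l.1 < n).
Proof. by case: l => i [] /=; rewrite /lcode /=; lia. Qed.

Lemma gcode_inj : injective gcode.
Proof.
elim=> [|l u IH] [|m v] //= [] /pair_code_inj[/lcode_inj-> /IH->//].
Qed.

Lemma gcode_surj n : exists w, gcode w = n.
Proof.
elim/ltn_ind: n => -[_|n IH]; first by exists [::].
have [l [c nE]] := pair_codeP n.
have [|w wc] := IH c.
  by rewrite nE ltnS /pair_code /=; exact: leq_addr.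
by exists ((l./2, odd l) :: w); rewrite /= lcode_surj wc -nE.
Qed.

Definition gdec n : gword := sval (cid (gcode_surj n)).

Lemma gdecK : cancel gdec gcode.
Proof. by move=> n; rewrite /gdec; case: cid. Qed.

Lemma gcodeK : cancel gcode gdec.
Proof. by move=> w; apply: gcode_inj; rewrite gdecK. Qed.

(* Twice Cantor's equation for [c = (pair_code l a).+1]. *)
Definition cons_eq (l a c : nat) : Prop :=
  c + c = (a + a + (a + l) * (a + l).+1).+2.

Lemma cons_eqP l a c : cons_eq l a c <-> c = (pair_code l a).+1.
Proof.
have := Cantor.to_nat_spec l a; rewrite -/(pair_code l a) /cons_eq.
by rewrite !multE !plusE => e; split; lia.
Qed.

Lemma cons_eq_gcode l w : cons_eq (lcode l) (gcode w) (gcode (l :: w)).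
Proof. exact/cons_eqP. Qed.

Lemma cons_eq_gdec l a c : cons_eq l a c -> gdec c = (l./2, odd l) :: gdec a.
Proof.
by move/cons_eqP->; apply: gcode_inj; rewrite gdecK /= gdecK lcode_surj.
Qed.

(** A pairing given by a term, without the division in Cantor's pairing. It is injective because
    $b\leq a+b$ makes $a+b$ the integer square root of the value. *)
Definition sqpair (a b : nat) : nat := (a + b) * (a + b) + b.

Lemma sqpair_inj a b c d : sqpair a b = sqpair c d -> a = c /\ b = d.
Proof.
rewrite /sqpair => e; have [h|h|h] := ltngtP (a + b) (c + d); first by nia.
  by nia.
by rewrite h in e; lia.
Qed.

Definition idx (t u v w : nat) : nat := sqpair (sqpair t u) (sqpair v w).

Lemma idx_inj t u v w t' u' v' w' : idx t u v w = idx t' u' v' w' ->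
  [/\ t = t', u = u', v = v' & w = w'].
Proof. by move=> /sqpair_inj[/sqpair_inj[-> ->] /sqpair_inj[-> ->]]. Qed.

Definition sqpairF (a b : tm) : tm := Add (Mul (Add a b) (Add a b)) b.

Definition idxF (t : nat) (u v w : tm) : tm :=
  sqpairF (sqpairF (numeral t) u) (sqpairF v w).

Definition consF (l a c : tm) : qfcon :=
  KEq (Add c c) (Succ (Succ (Add (Add a a) (Mul (Add a l) (Succ (Add a l)))))).

Section Represented.

Variable D : structure.
Hypothesis satPA : forall phi, peano phi -> forall e : nat -> D, sat e phi.

Lemma represented_preimage X t : tm_bounded 1 t -> represented D X ->
  represented D [set n | X (evalN (fun=> n) t)].
Proof.
move=> bt [phi [bphi phiX]].
pose s i := if i is 0 then t else Zero.
exists (subst s phi); split=> [|e n]; first by apply: bounded_subst bphi _ => -[].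
rewrite sat_subst /= (phiX (fun=> zeroD)); apply: eq_sat_bounded bphi _ => -[] //= _.
rewrite -(evalt_num satPA); apply: eq_evalt_bounded bt _ => -[]//.
Qed.

Lemma representedI X Y : represented D X -> represented D Y ->
  represented D (X `&` Y).
Proof.
move=> [phi [bphi phiX]] [psi [bpsi psiY]]; exists (And phi psi).
split=> [|e n]; first by rewrite /= bphi bpsi.
by rewrite sat_And -phiX -psiY.
Qed.

End Represented.

(** * Extensions with represented word problem *)

Definition kernel n (G : groupType) (h : nat -> G) : set nat :=
  [set gcode w | w in [set w | over n w /\ wval h w = 1%g]].

Lemma kernel_gcode n (G : groupType) (h : nat -> G) w :
  kernel n h (gcode w) <-> over n w /\ wval h w = 1%g.
Proof. by split=> [[v vP /gcode_inj<-]|wP]; last exists w. Qed.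

Section Extension.

Variables (D : structure) (n n' k : nat) (K : set nat) (E F : seq gword).
Hypothesis satPA : forall phi, peano phi -> forall e : nat -> D, sat e phi.

(* The set [Y] codes the relation [u * v = w] on words (tag 0), the shift by
   [k] of the words over [n] (tag 1) and the set of words over [n'] (tag 2).
   The equation [(l + m).+1 = n.*2] expresses that [l < n.*2]. *)
Record extension_axioms (Y : set nat) : Prop := {
  ext_refl : forall u, Y (idx 0 0 u u);
  ext_cons : forall u v w l u1 w1, Y (idx 0 u v w) ->
    cons_eq l u u1 -> cons_eq l w w1 -> Y (idx 0 u1 v w1);
  ext_congr : forall u v w u1 v1, Y (idx 0 u v w) ->
    Y (idx 0 0 u u1) -> Y (idx 0 0 v v1) -> Y (idx 0 u1 v1 w);
  ext_func : forall u v w w1, Y (idx 0 u v w) -> Y (idx 0 u v w1) ->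
    Y (idx 0 0 w w1);
  ext_cancel : forall i u v, cons_eq (i + i).+1 0 u -> cons_eq (i + i) u v ->
    Y (idx 0 0 v 0);
  ext_cancelV : forall i u v, cons_eq (i + i) 0 u -> cons_eq (i + i).+1 u v ->
    Y (idx 0 0 v 0);
  ext_shift0 : Y (idx 1 0 0 0);
  ext_shift : forall u v l u1 v1 m, Y (idx 1 u v 0) -> cons_eq l u u1 ->
    cons_eq (k.*2 + l) v v1 -> (l + m).+1 = n.*2 -> Y (idx 1 u1 v1 0);
  ext_kernel : forall u v, Y (idx 1 u v 0) -> K u -> Y (idx 0 0 v 0);
  ext_Nkernel : forall u v, Y (idx 1 u v 0) -> Y (idx 0 0 v 0) -> K u;
  ext_over0 : Y (idx 2 0 0 0);
  ext_over : forall u l u1 m, Y (idx 2 u 0 0) -> cons_eq l u u1 ->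
    (l + m).+1 = n'.*2 -> Y (idx 2 u1 0 0);
  ext_over_tail : forall u l u1, Y (idx 2 u1 0 0) -> cons_eq l u u1 ->
    Y (idx 2 u 0 0);
  ext_over_head : forall u l u1 m, Y (idx 2 u1 0 0) -> cons_eq l u u1 ->
    l = n'.*2 + m -> False;
  ext_eq : forall w, w \in E -> Y (idx 0 0 (gcode w) 0);
  ext_neq : forall w, w \in F -> ~ Y (idx 0 0 (gcode w) 0) }.

Let In t u v w := KIn (idxF t u v w).

(** The first fourteen entries follow the order of the record fields and are retrieved by position.
    As 0 codes the empty word, tag 0 with first argument 0 expresses equality of words. *)
Let axiomsF (KF : form) : seq qfcon :=
  let x0 := Var 0 in let x1 := Var 1 in let x2 := Var 2 in
  let x3 := Var 3 in let x4 := Var 4 in let x5 := Var 5 in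
  [:: In 0 Zero x0 x0;
      KImp (In 0 x0 x1 x2) (KImp (consF x3 x0 x4) (KImp (consF x3 x2 x5)
        (In 0 x4 x1 x5)));
      KImp (In 0 x0 x1 x2) (KImp (In 0 Zero x0 x3) (KImp (In 0 Zero x1 x4)
        (In 0 x3 x4 x2)));
      KImp (In 0 x0 x1 x2) (KImp (In 0 x0 x1 x3) (In 0 Zero x2 x3));
      KImp (consF (Succ (Add x0 x0)) Zero x1) (KImp (consF (Add x0 x0) x1 x2)
        (In 0 Zero x2 Zero));
      KImp (consF (Add x0 x0) Zero x1) (KImp (consF (Succ (Add x0 x0)) x1 x2)
        (In 0 Zero x2 Zero));
      In 1 Zero Zero Zero;
      KImp (In 1 x0 x1 Zero) (KImp (consF x2 x0 x3)
        (KImp (consF (Add (numeral k.*2) x2) x1 x4)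
          (KImp (KEq (Succ (Add x2 x5)) (numeral n.*2)) (In 1 x3 x4 Zero))));
      KImp (In 1 x0 x1 Zero) (KImp (KForm KF) (In 0 Zero x1 Zero));
      KImp (In 1 x0 x1 Zero) (KImp (In 0 Zero x1 Zero) (KForm KF));
      In 2 Zero Zero Zero;
      KImp (In 2 x0 Zero Zero) (KImp (consF x1 x0 x2)
        (KImp (KEq (Succ (Add x1 x3)) (numeral n'.*2)) (In 2 x2 Zero Zero)));
      KImp (In 2 x2 Zero Zero) (KImp (consF x1 x0 x2) (In 2 x0 Zero Zero));
      KImp (In 2 x2 Zero Zero) (KImp (consF x1 x0 x2)
        (KImp (KEq x1 (Add (numeral n'.*2) x3)) KBot))]
  ++ [seq In 0 Zero (numeral (gcode w)) Zero | w <- E]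
  ++ [seq KImp (In 0 Zero (numeral (gcode w)) Zero) KBot | w <- F].

Let conjF := foldr KAnd (KImp KBot KBot).

Let conjF_nth Y nu s i : qf_true D Y nu (conjF s) -> i < size s ->
  qf_true D Y nu (nth KBot s i).
Proof. by elim: s i => [|c s IH] [|i] //= [c_true /IH]; last apply. Qed.

Let conjF_cat Y nu s s' : qf_true D Y nu (conjF s) -> qf_true D Y nu (conjF s') ->
  qf_true D Y nu (conjF (s ++ s')).
Proof. by move=> + h'; elim: s => //= c s IH [? /IH]. Qed.

Let conjF_map Y nu (f : gword -> qfcon) s : qf_true D Y nu (conjF (map f s)) <->
  forall w, w \in s -> qf_true D Y nu (f w).
Proof.
elim: s => [|v s IH] /=; first by split.
rewrite IH; split=> [[fv fs] w|h]; first by rewrite inE => /orP[/eqP->|/fs].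
by split=> [|w ws]; apply: h; rewrite inE ?eqxx ?ws ?orbT.
Qed.

Let conjF_catl Y nu s s' : qf_true D Y nu (conjF (s ++ s')) ->
  qf_true D Y nu (conjF s').
Proof. by elim: s => //= c s IH [_ /IH]. Qed.

Let conjF_catr Y nu s s' : qf_true D Y nu (conjF (s ++ s')) ->
  qf_true D Y nu (conjF s).
Proof. by elim: s => //= c s IH [? /IH]. Qed.

Let conjF_bounded m s : all (qf_bounded m) s -> qf_bounded m (conjF s).
Proof. by elim: s => //= c s IH /andP[-> /IH]. Qed.

Let axioms_con KF := iter 6 KAll (KQf (conjF (axiomsF KF))).

Let axioms_bounded KF : bounded 1 KF -> con_bounded 0 (axioms_con KF).
Proof.
move=> /(bounded_le (isT : 1 <= 6)) bKF; apply: conjF_bounded.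
rewrite /axiomsF !all_cat !all_map /= bKF !numeral_bounded /=.
by apply/andP; split; apply/allP => w _ /=; rewrite numeral_bounded.
Qed.

Let axioms_conP KF Y nu : bounded 1 KF ->
  (forall (e : nat -> D) m, K m <-> sat (scons (num m) e) KF) ->
  con_true D Y nu (axioms_con KF) <-> extension_axioms Y.
Proof.
move=> bKF KFP; pose env x0 x1 x2 x3 x4 x5 :=
  scons x0 (scons x1 (scons x2 (scons x3 (scons x4 (scons x5 nu))))).
have satKF x0 x1 x2 x3 x4 x5 : sat (@num D \o env x0 x1 x2 x3 x4 x5) KF <-> K x0.
  rewrite (KFP (@num D \o env x1 x2 x3 x4 x5 0)).
  by apply: eq_sat_bounded bKF _ => -[].
have -> : con_true D Y nu (axioms_con KF) <-> forall x5 x4 x3 x2 x1 x0,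
  qf_true D Y (env x0 x1 x2 x3 x4 x5) (conjF (axiomsF KF)) by [].
split=> [h|[]].
  have ax x0 x1 x2 x3 x4 x5 i := @conjF_nth Y (env x0 x1 x2 x3 x4 x5) _ i
    (h x5 x4 x3 x2 x1 x0).
  split.
  - by move=> u; exact: (ax u 0 0 0 0 0 0 isT).
  - by move=> u v w l u1 w1; exact: (ax u v w l u1 w1 1 isT).
  - by move=> u v w u1 v1; exact: (ax u v w u1 v1 0 2 isT).
  - by move=> u v w w1; exact: (ax u v w w1 0 0 3 isT).
  - by move=> i u v; exact: (ax i u v 0 0 0 4 isT).
  - by move=> i u v; exact: (ax i u v 0 0 0 5 isT).
  - exact: (ax 0 0 0 0 0 0 6 isT).
  - move=> u v l u1 v1 m uv cu cv lm.
    have := ax u v l u1 v1 m 7 isT; rewrite /= !evalN_numeral; exact.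
  - by move=> u v uv Ku; apply: (ax u v 0 0 0 0 8 isT) => //; apply/satKF.
  - by move=> u v uv v0; apply/(satKF u v 0 0 0 0)/(ax u v 0 0 0 0 9 isT).
  - exact: (ax 0 0 0 0 0 0 10 isT).
  - move=> u l u1 m uu cu lm.
    have := ax u l u1 m 0 0 11 isT; rewrite /= !evalN_numeral; exact.
  - by move=> u l u1; exact: (ax u l u1 0 0 0 12 isT).
  - move=> u l u1 m uu cu lm.
    have := ax u l u1 m 0 0 13 isT; rewrite /= !evalN_numeral; exact.
  - have /conjF_catl/conjF_catr/conjF_map wE := h 0 0 0 0 0 0.
    by move=> w /wE /=; rewrite evalN_numeral.
  - have /conjF_catl/conjF_catl/conjF_map wF := h 0 0 0 0 0 0.
    by move=> w /wF /=; rewrite evalN_numeral.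
move=> a1 a2 a3 a4 a5 a6 a7 a8 a9 a10 a11 a12 a13 a14 a15 a16.
move=> x5 x4 x3 x2 x1 x0.
apply: conjF_cat; last apply: conjF_cat; last first.
- by apply/conjF_map => w /a16 h /=; rewrite evalN_numeral.
- by apply/conjF_map => w /a15 h /=; rewrite evalN_numeral.
rewrite /conjF /= !evalN_numeral satKF.
do !split => //.
- exact: a1.
- exact: a2.
- exact: a3.
- exact: a4.
- exact: a5.
- exact: a6.
- exact: a8.
- exact: a9.
- exact: a10.
- exact: a12.
- exact: a13.
- exact: a14.
Qed.

Let gdec0 : gdec 0 = [::].
Proof. exact: (gcodeK [::]). Qed.

Lemma extension_axioms_ex (H : groupType) (h : nat -> H) :
  (forall w, over n w -> wval h (wshift k w) = 1%g <-> K (gcode w)) ->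
  (forall w, w \in E -> wval h w = 1%g) ->
  (forall w, w \in F -> wval h w <> 1%g) ->
  exists Y, extension_axioms Y.
Proof.
move=> hK hE hF.
(* The intended meaning of the three tags, read off from [H], whose word problem is arbitrary. *)
pose rel t u v w := match t with
  | 0 => (wval h u * wval h v = wval h w)%g
  | 1 => over n u /\ v = wshift k u
  | 2 => over n' u
  | _ => False
  end.
pose Y m := exists t u v w, m = idx t u v w /\ rel t (gdec u) (gdec v) (gdec w).
have YE t u v w : Y (idx t u v w) <-> rel t (gdec u) (gdec v) (gdec w).
  split=> [[t' [u' [v' [w' [/idx_inj[-> -> -> ->]]]]]]//|r].
  by exists t, u, v, w.
have Y0 u v : Y (idx 0 0 u v) <-> wval h (gdec u) = wval h (gdec v).
  by rewrite YE /= gdec0 wval_nil mul1g.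
have YK w : Y (idx 0 0 (gcode w) 0) <-> wval h w = 1%g.
  by rewrite Y0 gcodeK gdec0 wval_nil.
have halves i : ((i + i)./2 = i) * (uphalf (i + i) = i).
  by rewrite addnn uphalf_half odd_double doubleK.
have odds i : odd (i + i) = false by rewrite addnn odd_double.
have half_lt l m : l < m.*2 -> l./2 < m by lia.
exists Y; split.
- by move=> u; apply/Y0.
- move=> u v w l u1 w1 /YE /= uvw /cons_eq_gdec uE /cons_eq_gdec wE.
  by apply/YE; rewrite /= uE wE !wval_cons -mulgA uvw.
- by move=> u v w u1 v1 /YE /= uvw /Y0 uE /Y0 vE; apply/YE; rewrite /= -uE -vE.
- by move=> u v w w1 /YE /= uvw /YE /= uvw1; apply/Y0; rewrite -uvw.
- move=> i u v /cons_eq_gdec uE /cons_eq_gdec vE; apply/Y0.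
  rewrite vE uE gdec0 !wval_cons wval_nil /= !halves odds /=.
  by rewrite mulg1 mulgV.
- move=> i u v /cons_eq_gdec uE /cons_eq_gdec vE; apply/Y0.
  rewrite vE uE gdec0 !wval_cons wval_nil /= !halves odds /=.
  by rewrite mulg1 mulVg.
- by apply/YE; rewrite /= gdec0.
- move=> u v l u1 v1 m /YE /= [un vE] /cons_eq_gdec uE /cons_eq_gdec v1E lm.
  apply/YE; rewrite /= uE v1E /= un vE halfD odd_double doubleK oddD odd_double.
  by rewrite half_lt// -lm ltnS leq_addr.
- move=> u v /YE /= [un vE] Ku; apply/Y0; rewrite gdec0 wval_nil vE.
  by apply/(hK _ un); rewrite gdecK.
- move=> u v /YE /= [un vE] /Y0; rewrite gdec0 wval_nil vE => /(hK _ un).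
  by rewrite gdecK.
- by apply/YE; rewrite /= gdec0.
- move=> u l u1 m /YE /= un /cons_eq_gdec uE lm; apply/YE; rewrite /= uE /= un.
  by rewrite half_lt// -lm ltnS leq_addr.
- by move=> u l u1 /YE /= + /cons_eq_gdec uE; rewrite uE => /andP[_ ?]; apply/YE.
- by move=> u l u1 m /YE /= + /cons_eq_gdec uE; rewrite uE => /andP[/= ? _]; lia.
- by move=> w /hE wE; apply/YK.
- by move=> w /hF wF /YK.
Qed.

(** By [ext_cons] the relation contains every product of words given by concatenation; with
    uniqueness of products, tag 0 then yields a congruence, whose quotient is the group. *)
Lemma extension_axioms_group Y : extension_axioms Y ->
  exists (H : groupType) (h : nat -> H),
    [/\ forall w, over n w -> wval h (wshift k w) = 1%g <-> K (gcode w),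
        forall w, w \in E -> wval h w = 1%g,
        forall w, w \in F -> wval h w <> 1%g
      & kernel n' h = [set m | Y (idx 0 0 m 0)] `&` [set m | Y (idx 2 m 0 0)]].
Proof.
move=> aY; pose r u v := Y (idx 0 0 (gcode u) (gcode v)).
have r_refl u : r u u by exact: ext_refl.
(* The product of the empty word and [u] is both [v] and [u]. *)
have r_sym u v : r u v -> r v u.
  by move=> uv; apply: (ext_func aY uv); exact: ext_refl.
have r_trans u v w : r u v -> r v w -> r u w.
  by move=> /r_sym vu vw; exact: (ext_func aY vu vw).
have mulY u v : Y (idx 0 (gcode u) (gcode v) (gcode (u ++ v))).
  elim: u => [|l u IH]; first exact: ext_refl.
  by apply: (ext_cons aY IH); exact: cons_eq_gcode.
have r_cat u u' v v' : r u u' -> r v v' -> r (u ++ v) (u' ++ v').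
  move=> uu' vv'; apply: (ext_func aY _ (mulY u' v')).
  exact: ext_congr (mulY u v) uu' vv'.
have r_cancel i e : r [:: (i, e); (i, ~~ e)] [::].
  have iE : (lcode (i, false) = i + i) * (lcode (i, true) = (i + i).+1).
    by rewrite /lcode /= addn0 addn1 addnn.
  case: e.
    by apply: (ext_cancelV aY (i := i) (u := gcode [:: (i, false)]));
      rewrite -iE; exact: cons_eq_gcode.
  by apply: (ext_cancel aY (i := i) (u := gcode [:: (i, true)]));
    rewrite -iE; exact: cons_eq_gcode.
have [H [h [_ hP _]]] := congruence_group
  (Congruence r_refl r_sym r_trans r_cat r_cancel).
have h1 w : wval h w = 1%g <-> Y (idx 0 0 (gcode w) 0).
  by rewrite -(wval_nil h) hP.
have shiftY w : over n w -> Y (idx 1 (gcode w) (gcode (wshift k w)) 0).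
  elim: w => [_|l w IH /andP[ln /IH wY]]; first exact: ext_shift0.
  apply: (ext_shift aY wY (cons_eq_gcode l w) (m := n.*2 - (lcode l).+1)).
    have <- : lcode (k + l.1, l.2) = k.*2 + lcode l by rewrite /lcode doubleD addnA.
    exact: cons_eq_gcode.
  by have := lcode_lt l n; lia.
have overY w : over n' w <-> Y (idx 2 (gcode w) 0 0).
  elim: w => [|l w IH]; first by split=> // _; exact: ext_over0.
  split=> [/andP[ln /IH wY]|lwY].
    apply: (ext_over aY wY (cons_eq_gcode l w) (m := n'.*2 - (lcode l).+1)).
    by have := lcode_lt l n'; lia.
  rewrite /=; apply/andP; split; last first.
    by apply/IH/(ext_over_tail aY lwY); exact: cons_eq_gcode.
  rewrite -lcode_lt ltnNge; apply/negP => le.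
  by apply: (ext_over_head aY lwY (cons_eq_gcode l w) (m := lcode l - n'.*2)); lia.
exists H, h; split.
- move=> w wn; rewrite h1; split=> [|Kw]; first exact: ext_Nkernel (shiftY _ wn).
  exact: ext_kernel (shiftY _ wn) Kw.
- by move=> w wE; apply/h1; exact: (ext_eq aY).
- by move=> w wF /h1; exact: (ext_neq aY).
- apply/seteqP; split=> [_ [w [wn' /h1 w1] <-]|m]; first by split=> //; apply/overY.
  by rewrite -[m]gdecK => -[m1 /overY mn']; exists (gdec m) => //; split=> //; apply/h1.
Qed.

(** The old generators are the letters from [k] to [k + n - 1]. The chain takes [k = 0]; for the
    word problem of a tuple, [k] is its length and the letters below [k] name its entries. *)
Lemma represented_extension (H : groupType) (h : nat -> H) :
  represented D K ->
  (forall w, over n w -> wval h (wshift k w) = 1%g <-> K (gcode w)) ->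
  (forall w, w \in E -> wval h w = 1%g) ->
  (forall w, w \in F -> wval h w <> 1%g) ->
  exists (H' : groupType) (h' : nat -> H'),
    [/\ forall w, over n w -> wval h' (wshift k w) = 1%g <-> K (gcode w),
        forall w, w \in E -> wval h' w = 1%g,
        forall w, w \in F -> wval h' w <> 1%g
      & represented D (kernel n' h')].
Proof.
move=> [KF [bKF KFP]] hK hE hF.
have [Z /(axioms_conP Z id bKF KFP) Zc] := extension_axioms_ex hK hE hF.
have [Y [reprY /(axioms_conP Y id bKF KFP) aY]] :=
  represented_solution satPA (axioms_bounded bKF) Zc.
have [H' [h' [h'K h'E h'F kerE]]] := extension_axioms_group aY.
exists H', h'; split=> //; rewrite kerE; apply: representedI.
  by apply: (@represented_preimage _ satPA Y (idxF 0 Zero (Var 0) Zero)) reprY.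
by apply: (@represented_preimage _ satPA Y (idxF 2 (Var 0) Zero Zero)) reprY.
Qed.

End Extension.

(** * The existentially closed group *)

Section Chain.

Variable D : structure.
Hypothesis satPA : forall phi, peano phi -> forall e : nat -> D, sat e phi.

(** Only the number of generators and the kernel are kept, as the basis theorem returns another
    group at every step. *)
Definition stage (s : nat * set nat) : Prop := represented D s.2 /\
  exists (H : groupType) (h : nat -> H), s.2 = kernel s.1 h.

(* In the words of a task the even letters are generators of the current
   group, the odd ones are unknowns, which become the generators from [n]. *)
Definition rename n (w : gword) : gword :=
  [seq (if odd l.1 then n + l.1./2 else l.1./2, l.2) | l <- w].

Definition task : Type := (seq gword * seq gword)%type.

Definition solvable (t : task) (s : nat * set nat) : Prop :=
  exists (H : groupType) (h : nat -> H), [/\ s.2 = kernel s.1 h,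
    forall w, w \in t.1 -> wval h (rename s.1 w) = 1%g &
    forall w, w \in t.2 -> wval h (rename s.1 w) <> 1%g].

Definition solved (t : task) n (K : set nat) : Prop :=
  (forall w, w \in t.1 -> K (gcode (rename n w))) /\
  (forall w, w \in t.2 -> ~ K (gcode (rename n w))).

(** The strict inequality makes every letter a generator eventually. *)
Definition extends (t : task) (s s' : nat * set nat) : Prop := [/\ s.1 < s'.1,
  forall w, over s.1 w -> s'.2 (gcode w) <-> s.2 (gcode w) &
  solvable t s ->
    (forall w, w \in t.1 ++ t.2 -> over s'.1 (rename s.1 w)) /\
    solved t s.1 s'.2].

Lemma wshift0 w : wshift 0 w = w.
Proof. by rewrite /wshift map_id_in// => -[]. Qed.

Lemma over_all_ex (s : seq gword) : exists n, forall w, w \in s -> over n w.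
Proof.
elim: s => [|v s [n sn]]; first by exists 0.
have [m vm] := over_ex v; exists (maxn m n) => w.
rewrite inE => /orP[/eqP->|/sn]; [apply: over_le vm|apply: over_le].
  exact: leq_maxl.
exact: leq_maxr.
Qed.

Lemma stage_extend t s : stage s -> exists s', stage s' /\ extends t s s'.
Proof.
case: s => n K [/= reprK [H0 [h0 KE0]]].
have [n0 n0P] := over_all_ex [seq rename n w | w <- t.1 ++ t.2].
(* [n.+1] makes the stages grow strictly, [n0] leaves room for the unknowns of the task. *)
pose n' := maxn n.+1 n0.
have n'P w : w \in t.1 ++ t.2 -> over n' (rename n w).
  move=> wt; apply: (@over_le n0); first exact: leq_maxr.
  by apply: n0P; exact: map_f.
have step (E F : seq gword) (H : groupType) (h : nat -> H) : K = kernel n h ->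
    (forall w, w \in E -> wval h w = 1%g) ->
    (forall w, w \in F -> wval h w <> 1%g) ->
    exists K', [/\ stage (n', K'),
      forall w, over n w -> K' (gcode w) <-> K (gcode w),
      forall w, w \in E -> over n' w -> K' (gcode w) &
      forall w, w \in F -> ~ K' (gcode w)].
  move=> KE hE hF.
  have hK w : over n w -> wval h (wshift 0 w) = 1%g <-> K (gcode w).
    by move=> wn; rewrite wshift0 KE kernel_gcode; split=> [|[]].
  have [H' [h' [h'K h'E h'F repr']]] :=
    @represented_extension D n n' 0 K E F satPA H h reprK hK hE hF.
  exists (kernel n' h'); split.
  - by split=> //; exists H', h'.
  - move=> w wn; rewrite kernel_gcode -h'K// wshift0.
    split=> [[]//|w1]; split=> //; apply: over_le wn.
    by rewrite leq_max leqnSn.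
  - by move=> w /h'E wE wn'; apply/kernel_gcode.
  - by move=> w /h'F wF /kernel_gcode[].
have nn' : n < n' by rewrite leq_max leqnn.
have [[H [h [/= KE hE hF]]]|nsol] := pselect (solvable t (n, K)); last first.
  (* An unsolvable task is replaced by the empty one, so that the chain goes on. *)
  have [//|//|K' [st' K'K _ _]] := @step [::] [::] H0 h0 KE0.
  by exists (n', K'); split=> //; split.
have [_ /mapP[w wt ->]|_ /mapP[w wt ->]|K' [st' K'K K'E K'F]] :=
  @step [seq rename n w | w <- t.1] [seq rename n w | w <- t.2] H h KE.
- exact: hE.
- exact: hF.
exists (n', K'); split=> //; split=> // _; split=> //; split=> w wt.
  by apply: K'E; [exact: map_f|apply: n'P; rewrite mem_cat wt].
by apply: K'F; exact: map_f.
Qed.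

(** No generators: the only word is the empty one, with code 0. *)
Lemma stage0 : stage (0, [set 0]).
Proof.
split.
  exists (Eq (Var 0) Zero); split=> // e n /=; split=> [->//|n0].
  exact: (@num_inj _ satPA n 0 n0).
have c : congruence by exists (fun _ _ => True).
have [H [h _]] := congruence_group c.
exists H, h; apply/seteqP; split=> [_ ->|_ [[|l w] [wn _] <-]//].
by exists [::] => //; split=> //; exact: wval_nil.
Qed.

(* Every task is considered at arbitrarily late stages. *)
Lemma chain_ex : exists s : nat -> nat * set nat, forall k,
  stage (s k) /\
  extends (odflt ([::], [::]) (unpickle (Cantor.of_nat k).1)) (s k) (s k.+1).
Proof.
pose t k : task := odflt ([::], [::]) (unpickle (Cantor.of_nat k).1).
have step k (s : {s | stage s}) : exists s' : {s | stage s},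
    extends (t k) (sval s) (sval s').
  by have [s' [st' ss']] := stage_extend (t k) (svalP s); exists (exist _ s' st').
pose f k := projT1 (choice (step k)).
have fP k s : extends (t k) (sval s) (sval (f k s)) := projT2 (choice (step k)) s.
pose S := fix S k := if k is i.+1 then f i (S i) else exist _ _ stage0.
by exists (sval \o S) => k; split; [exact: svalP|exact: fP].
Qed.

(** * The direct limit of the chain *)

Section Limit.

Variable s : nat -> nat * set nat.
Hypothesis sP : forall k, stage (s k) /\
  extends (odflt ([::], [::]) (unpickle (Cantor.of_nat k).1)) (s k) (s k.+1).

Let n k := (s k).1.
Let K k := (s k).2.

Let n_le i k : i <= k -> n i <= n k.
Proof.
move=> /subnK<-; elim: (k - i) => // d /leq_trans; apply.
by rewrite addSn ltnW//; case: (sP (d + i)) => _ [].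
Qed.

Let k_le_n k : k <= n k.
Proof.
by elim: k => // k /leq_ltn_trans; apply; case: (sP k) => _ [].
Qed.

Let K_le i k w : i <= k -> over (n i) w -> K k (gcode w) <-> K i (gcode w).
Proof.
move=> /subnK<- wi; elim: (k - i) => // d <-; rewrite addSn.
have [_ [_ + _]] := sP (d + i); apply; apply: over_le wi.
by apply: n_le; exact: leq_addl.
Qed.

Let over_n k w : over k w -> over (n k) w.
Proof. exact/over_le/k_le_n. Qed.

Let limit_rel u v := exists k,
  [/\ over (n k) u, over (n k) v & K k (gcode (u ++ winv v))].

(** Kernels of different stages agree on common words, so the relation can be read off in the group
    of any stage that covers both words. The laws of a congruence are thereby inherited from
    groups. *)
Let limit_relP k (H : groupType) (h : nat -> H) u v : K k = kernel (n k) h ->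
  over (n k) u -> over (n k) v -> limit_rel u v <-> wval h u = wval h v.
Proof.
move=> KE uk vk; have uvk : over (n k) (u ++ winv v) by rewrite over_cat over_inv uk.
have uvE : wval h u = wval h v <-> K k (gcode (u ++ winv v)).
  rewrite KE kernel_gcode uvk wval_cat wval_inv.
  by split=> [->|[_ /divg1_eq//]]; rewrite mulgV.
rewrite uvE; split=> [[i [ui vi]]|]; last by exists k.
have uvi : over (n i) (u ++ winv v) by rewrite over_cat over_inv ui.
by rewrite -(K_le (leq_maxl i k) uvi) -(K_le (leq_maxr i k) uvk).
Qed.

Let limit_stage (ws : seq gword) : exists k (H : groupType) (h : nat -> H),
  (forall w, w \in ws -> over (n k) w) /\ K k = kernel (n k) h.
Proof.
have [k wsk] := over_all_ex ws; have [[_ [H [h KE]]] _] := sP k.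
by exists k, H, h; split=> // w /wsk; exact: over_n.
Qed.

Let limit_refl u : limit_rel u u.
Proof.
have [k [H [h [ok KE]]]] := limit_stage [:: u].
by apply/(limit_relP KE) => //; apply: ok; rewrite !inE eqxx.
Qed.

Let limit_sym u v : limit_rel u v -> limit_rel v u.
Proof.
have [k [H [h [ok KE]]]] := limit_stage [:: u; v].
have [uk vk] : over (n k) u /\ over (n k) v by split; apply: ok; rewrite !inE eqxx ?orbT.
by move=> /(limit_relP KE uk vk) uv; exact/(limit_relP KE vk uk).
Qed.

Let limit_trans u v w : limit_rel u v -> limit_rel v w -> limit_rel u w.
Proof.
have [k [H [h [ok KE]]]] := limit_stage [:: u; v; w].
have [uk vk wk] : [/\ over (n k) u, over (n k) v & over (n k) w].
  by split; apply: ok; rewrite !inE eqxx ?orbT.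
move=> /(limit_relP KE uk vk) uv /(limit_relP KE vk wk) vw.
by apply/(limit_relP KE uk wk); rewrite uv.
Qed.

Let limit_cat u u' v v' : limit_rel u u' -> limit_rel v v' ->
  limit_rel (u ++ v) (u' ++ v').
Proof.
have [k [H [h [ok KE]]]] := limit_stage [:: u; u'; v; v'].
have [[uk u'k] [vk v'k]] : (over (n k) u /\ over (n k) u') /\
    (over (n k) v /\ over (n k) v').
  by do !split; apply: ok; rewrite !inE eqxx ?orbT.
move=> /(limit_relP KE uk u'k) uu' /(limit_relP KE vk v'k) vv'.
by apply/(limit_relP KE); rewrite ?over_cat ?uk ?vk ?u'k ?v'k// !wval_cat uu' vv'.
Qed.

Let limit_cancel i e : limit_rel [:: (i, e); (i, ~~ e)] [::].
Proof.
have [k [H [h [ok KE]]]] := limit_stage [:: [:: (i, e); (i, ~~ e)]].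
apply/(limit_relP KE) => //; first by apply: ok; rewrite inE.
rewrite !wval_cons wval_nil mulg1 /=; case: e {ok} => /=.
  exact: mulVg.
exact: mulgV.
Qed.

Let limit_group := congruence_group
  (Congruence limit_refl limit_sym limit_trans limit_cat limit_cancel).

Lemma limit_ex : exists (M : groupType) (m : nat -> M),
  [/\ countable [set: M], forall x, exists w, x = wval m w &
      forall k, K k = kernel (n k) m].
Proof.
have [M [m [cM mP mS]]] := limit_group; exists M, m; split=> // k.
have [[_ [H [h KE]]] _] := sP k.
suff mh w : over (n k) w -> wval m w = 1%g <-> wval h w = 1%g.
  by rewrite /K KE; apply/seteqP; split=> _ [w [wk w1] <-]; exists w => //;
    split=> //; apply/mh.
move=> wk; rewrite -(wval_nil m) mP /= -(wval_nil h).
exact: (@limit_relP k H h w [::] KE wk isT).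
Qed.

End Limit.

End Chain.

(** * Quantifier-free formulas as conditions on words *)

Section Terms.

Variables (P : Type) (rep : P -> gword).

Fixpoint tm_word (t : gterm P) : gword :=
  match t with
  | GVar i => [:: (i.*2.+1, false)]
  | GParam p => [seq (l.1.*2, l.2) | l <- rep p]
  | GOne => [::]
  | GMul t1 t2 => tm_word t1 ++ tm_word t2
  | GInv t1 => winv (tm_word t1)
  end.

(** One word with all letters that the parameters use, so that a single bound covers them. *)
Fixpoint tm_params (t : gterm P) : gword :=
  match t with
  | GVar _ | GOne => [::]
  | GParam p => rep p
  | GMul t1 t2 => tm_params t1 ++ tm_params t2
  | GInv t1 => tm_params t1
  end.

Fixpoint qf_words (phi : qfform P) : seq gword :=
  match phi with
  | QEq t1 t2 => [:: tm_word t1 ++ winv (tm_word t2)]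
  | QNot phi1 => qf_words phi1
  | QAnd phi1 phi2 | QOr phi1 phi2 => qf_words phi1 ++ qf_words phi2
  end.

Fixpoint qf_params (phi : qfform P) : gword :=
  match phi with
  | QEq t1 t2 => tm_params t1 ++ tm_params t2
  | QNot phi1 => qf_params phi1
  | QAnd phi1 phi2 | QOr phi1 phi2 => qf_params phi1 ++ qf_params phi2
  end.

Lemma rename_cat n u v : rename n (u ++ v) = rename n u ++ rename n v.
Proof. exact: map_cat. Qed.

Lemma rename_inv n w : rename n (winv w) = winv (rename n w).
Proof. by rewrite /rename /winv map_rev -!map_comp. Qed.

Definition interprets n (N : groupType) (par : P -> N) (x h : nat -> N) : Prop :=
  (forall p, over n (rep p) -> wval h (rep p) = par p) /\
  (forall i, h (n + i) = x i).

Lemma wval_tm_word n (N : groupType) (par : P -> N) (x h : nat -> N) t :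
  interprets n par x h -> over n (tm_params t) ->
  wval h (rename n (tm_word t)) = gterm_val par x t.
Proof.
move=> [hpar hx]; elim: t => /= [i _|p /hpar <-|_|t IHt u IHu|t IHt].
- by rewrite /rename /= odd_double wval_gen uphalf_double hx.
- rewrite /rename -map_comp map_id_in// => -[i e] _ /=.
  by rewrite odd_double doubleK.
- exact: wval_nil.
- by rewrite over_cat => /andP[/IHt tE /IHu uE]; rewrite rename_cat wval_cat tE uE.
- by move=> /IHt tE; rewrite rename_inv wval_inv tE.
Qed.

(** Carries a solution from one group to another: a task that prescribes for each word of [phi]
    whether it is trivial fixes the truth of [phi]. *)
Lemma qf_holds_words n (N N' : groupType) (par : P -> N) (par' : P -> N')
    (x h : nat -> N) (x' h' : nat -> N') phi :
  interprets n par x h -> interprets n par' x' h' -> over n (qf_params phi) ->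
  (forall w, w \in qf_words phi ->
    wval h (rename n w) = 1%g <-> wval h' (rename n w) = 1%g) ->
  qf_holds par x phi <-> qf_holds par' x' phi.
Proof.
move=> hN hN'; elim: phi => /= [t u|f IHf|f IHf g IHg|f IHf g IHg].
- rewrite over_cat => /andP[tn un] /(_ _ (mem_head _ _)).
  rewrite rename_cat rename_inv !wval_cat !wval_inv.
  rewrite !(wval_tm_word hN)// !(wval_tm_word hN')// => e.
  by split=> tu; apply/divg1_eq/e; rewrite tu mulgV.
- by move=> fn fw; rewrite IHf.
- rewrite over_cat => /andP[fn gn] w; rewrite IHf// ?IHg// => v vw; apply: w;
  by rewrite mem_cat vw ?orbT.
- rewrite over_cat => /andP[fn gn] w; rewrite IHf// ?IHg// => v vw; apply: w;
  by rewrite mem_cat vw ?orbT.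
Qed.

End Terms.

(** * Existential closedness and word problems of the limit *)

Section LimitGroup.

Variables (D : structure) (s : nat -> nat * set nat).
Hypothesis satPA : forall phi, peano phi -> forall e : nat -> D, sat e phi.
Hypothesis sP : forall k, stage D (s k) /\
  extends (odflt ([::], [::]) (unpickle (Cantor.of_nat k).1)) (s k) (s k.+1).
Variables (M : groupType) (m : nat -> M) (rep : M -> gword).
Hypothesis repE : forall x, wval m (rep x) = x.
Hypothesis kerM : forall k, (s k).2 = kernel (s k).1 m.

Let n k := (s k).1.

Let k_le_n k : k <= n k.
Proof. by elim: k => // k /leq_ltn_trans; apply; case: (sP k) => _ []. Qed.

Let kerMP k w : (s k).2 (gcode w) <-> over (n k) w /\ wval m w = 1%g.
Proof. by rewrite kerM kernel_gcode. Qed.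

(** The task records for all words of [phi] whether they are trivial in [N], so negations and
    disjunctions require no normal form. *)
Lemma limit_existentially_closed : existentially_closed M.
Proof.
move=> phi N j j_inj [x phix].
have j1 : j 1%g = 1%g by apply: (mulgI (j 1%g)); rewrite -gmulfM !mulg1.
have jV y : j y^-1%g = (j y)^-1%g.
  by apply: (mulgI (j y)); rewrite -gmulfM !mulgV.
have jw w : wval (j \o m) w = j (wval m w).
  elim: w => [|l w IH]; first by rewrite !wval_nil j1.
  by rewrite !wval_cons IH gmulfM /=; case: l.2; rewrite ?jV.
pose words := qf_words rep phi.
have [n0 phin0] := over_ex (qf_params rep phi).
have [n1 wordsn1] := over_all_ex words.
pose g i : N := if odd i then x i./2 else j (m i./2).
pose t : task := ([seq w <- words | `[< wval g w = 1%g >]],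
                  [seq w <- words | ~~ `[< wval g w = 1%g >]]).
(* The second component makes this occurrence of the task late enough for the stage to name all
   parameters. *)
pose k := Cantor.to_nat (pickle t, maxn n0 n1).
have k_max : maxn n0 n1 <= k by exact: leq_addr.
have phink : over (n k) (qf_params rep phi).
  apply: over_le phin0; apply: leq_trans (k_le_n k).
  by apply: leq_trans k_max; exact: leq_maxl.
have wordsnk w : w \in words -> over (n k) w.
  move=> /wordsn1; apply: over_le; apply: leq_trans (k_le_n k).
  by apply: leq_trans k_max; exact: leq_maxr.
(* Generators of the stage go to their images in [N], the later letters to the solution. *)
pose h i : N := if i < n k then j (m i) else x (i - n k).
have hw w : over (n k) w -> wval h w = j (wval m w).
  by move=> wn; rewrite -jw; apply: (eq_wval_over wn) => i i_n; rewrite /h i_n.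
have hx i : h (n k + i) = x i by rewrite /h ltnNge leq_addr /= addKn.
have hg w : over (n k) w -> wval h (rename (n k) w) = wval g w.
  elim: w => [_|[i e] w IH /andP[/= i_n /IH wE]]; first by rewrite !wval_nil.
  rewrite !wval_cons wE /= (_ : h _ = g i)// /g.
  case: ifP => _; first by rewrite hx.
  by rewrite /h (leq_ltn_trans _ i_n)//; lia.
have solN : solvable t (s k).
  exists N, h; split=> /=.
  - rewrite kerM; apply/seteqP; split=> _ [w [wn w1] <-]; exists w => //; split=> //.
      by rewrite hw// w1.
    by apply: j_inj; rewrite j1 -hw.
  - move=> w; rewrite mem_filter => /andP[/asboolP w1 ww].
    by rewrite hg ?wordsnk.
  - move=> w; rewrite mem_filter => /andP[/asboolP w1 ww].
    by rewrite hg ?wordsnk.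
have [_ [_ _]] := sP k.
rewrite (_ : odflt _ _ = t); last by rewrite Cantor.cancel_of_to pickleK.
move=> /(_ solN) [overE [solE solF]].
have mN w : w \in words ->
    wval h (rename (n k) w) = 1%g <-> wval m (rename (n k) w) = 1%g.
  move=> ww; rewrite hg ?wordsnk//; have [w1|w1] := pselect (wval g w = 1%g).
    have wt : w \in t.1 by rewrite mem_filter ww andbT; exact/asboolP.
    by have /kerMP[_ ->] := solE _ wt.
  have wt : w \in t.2 by rewrite mem_filter ww andbT; exact/asboolP.
  split=> // mw; case: (solF _ wt); apply/kerMP; split=> //.
  by apply: overE; rewrite mem_cat wt orbT.
exists (fun i => m (n k + i)).
have hN : interprets rep (n k) j x h.
  by split=> // y yn; rewrite hw// repE.
have hM : interprets rep (n k) id (fun i => m (n k + i)) m by split.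
exact: (iffLR (qf_holds_words hN hM phink mN)).
Qed.

(** The extension step is applied to [M] itself, with a letter for each entry of [X], tied by [E] to
    a word in the generators of one stage. These equations leave no freedom: the kernel on the new
    letters is determined by that of the stage, so every solution has the kernel [W X]. *)
Lemma limit_word_problem (X : seq M) : represented D (W X).
Proof.
have [n1 Xn1] := over_ex (flatten [seq rep x | x <- X]).
pose k := n1; pose N := n k; pose p := size X.
have XN x : x \in X -> over N (rep x).
  move=> xX; apply: (@over_le n1); first exact: k_le_n.
  apply/allP => l lx; apply: (allP Xn1); apply/flattenP.
  by exists (rep x) => //; exact: map_f.
pose h i := if i < p then nth 1%g X i else m (i - p).
have h_shift w : wval h (wshift p w) = wval m w.
  rewrite wval_shift; congr wval; apply/funext => i.
  by rewrite /h ltnNge leq_addr /= addKn.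
pose E := [seq (i, true) :: wshift p (rep (nth 1%g X i)) | i <- iota 0 p].
have hE w : w \in E -> wval h w = 1%g.
  move=> /mapP[i]; rewrite mem_iota => /andP[_ ip] ->.
  by rewrite wval_cons h_shift repE /= /h ip mulVg.
have hK w : over N w -> wval h (wshift p w) = 1%g <-> (s k).2 (gcode w).
  by move=> wN; rewrite h_shift kerMP; split=> [|[]].
have hF w : w \in [::] -> wval h w <> 1%g by [].
have [reprK _] := (sP k).1.
(* The stage's letters are moved up by [p], and only the kernel on the first [p] letters is
   retained. *)
have [H' [h' [h'K h'E _ repr]]] :=
  @represented_extension D N p p _ E [::] satPA M h reprK hK hE hF.
suff -> : W X = kernel p h' by [].
pose g i := h' (p + i).
have h'X i : i < p -> h' i = wval g (rep (nth 1%g X i)).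
  move=> ip; rewrite -wval_shift.
  have /h'E : (i, true) :: wshift p (rep (nth 1%g X i)) \in E.
    by apply: (map_f (fun i => (i, true) :: wshift p (rep (nth 1%g X i))));
      rewrite mem_iota.
  by rewrite wval_cons /= => /mulg1_eq; rewrite invgK.
pose sub (w : gword) := flatten [seq if l.2 then winv (rep (nth 1%g X l.1))
                                     else rep (nth 1%g X l.1) | l <- w].
have sub_over w : over p w -> over N (sub w).
  elim: w => // -[i e] w IH /andP[/= ip /IH wN].
  rewrite /sub /= over_cat -/(sub w) wN andbT.
  by case: e; rewrite ?over_inv; apply/XN/mem_nth.
have subX w : wval m (sub w) = wval (nth 1%g X) w.
  elim: w => [|[i e] w IH]; first by rewrite !wval_nil.
  rewrite /sub /= wval_cat -/(sub w) IH wval_cons /=.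
  by case: e; rewrite ?wval_inv repE.
have sub_h' w : over p w -> wval g (sub w) = wval h' w.
  elim: w => [_|[i e] w IH /andP[/= ip /IH wE]]; first by rewrite !wval_nil.
  rewrite /sub /= wval_cat -/(sub w) wE wval_cons /= h'X//.
  by case: e; rewrite ?wval_inv.
have kerE w : over p w -> wval h' w = 1%g <-> wval (nth 1%g X) w = 1%g.
  move=> wp; rewrite -sub_h'// -subX -wval_shift h'K ?sub_over// kerMP.
  by split=> [[]//|w1]; split=> //; exact: sub_over.
pose gw (w : word p) : gword := [seq (val l.1, l.2) | l <- w].
have gwE w : gcode (gw w) = word_code w by elim: w => //= l w ->.
have gw_over w : over p (gw w).
  by rewrite /over all_map; apply/allP => l _ /=.
have gw_val w : wval (nth 1%g X) (gw w) = word_val (in_tuple X) w.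
  rewrite /wval /word_val big_map; apply: eq_bigr => l _ /=.
  by rewrite !(tnth_nth 1%g).
have gw_surj w : over p w -> exists v, gw v = w.
  elim: w => [_|[i e] w IH /andP[/= ip /IH[v <-]]]; first by exists [::].
  by exists ((Ordinal ip, e) :: v).
apply/seteqP; split=> [_ [w w1 <-]|_ [w [wp w1] <-]].
  exists (gw w) => //; split; first exact: gw_over.
  by apply/kerE; rewrite ?gw_val.
have [v vw] := gw_surj w wp; exists v; last by rewrite -vw gwE.
by rewrite /= -gw_val vw; apply/kerE.
Qed.

End LimitGroup.

Theorem theorem6p2p2 (a : set (set nat)) (ha : PA_degree a) :
  exists M : groupType,
    [/\ countable [set: M],
        existentially_closed M &
        forall (G : set M) (X : seq M),
          Sk M G -> G = generated [set` X] ->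
          computed_by_degree (W X) a].
Proof.
have [_ [T [TPA [A [aA TA]]]]] := ha.
have [D DT] := complete_extension_model TPA.
have [sT PAT _ _] := TPA.
have satPA phi : peano phi -> forall e : nat -> D, sat e phi.
  by move=> /PAT Tphi e; apply/DT => //; exact: sT.
have [s sP] := chain_ex satPA.
have [M [m [cM mS kerM]]] := limit_ex sP.
have [rep repE] := choice mS.
exists M; split=> // [|G X _ _].
  by apply: (limit_existentially_closed sP (rep := rep)) => // x; rewrite -repE.
exists A; split=> //; apply: (represented_turing_le DT TA).
by apply: (limit_word_problem satPA sP (rep := rep) (m := m)) => // x; rewrite -repE.
Qed.
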